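(* Let $\{A_i\}_{i\in I}$ be positive self-adjoint operators with compact resolvent on separable Hilbert spaces $\{\mathcal H_i\}_{i\in I}$, and let $\mathcal S_i(t)=e^{-tA_i}$ for $t\ge 0$. The following are equivalent. (i) There exist positive scalars $\{\tau_i\}_{i\in I}$ and a family of bounded invertible operators $K_{ij}:\mathcal H_j\to\mathcal H_i$ ($i,j\in I$) such that, for all $i,j,k\in I$, $$K_{ik}=K_{ij}K_{jk},\qquad K_{ij}\mathcal S_j(t)=\mathcal S_i(\lambda_{ij}t)K_{ij}\ \text{ for all } t\ge0,\qquad\text{where }\lambda_{ij}=\frac{\tau_i}{\tau_j}.$$ (ii) There exist positive scalars $\{\tau_i\}_{i\in I}$ such that $\sigma(\tau_iA_i)=\sigma(\tau_jA_j)$ for all $i,j\in I$, and for every $\alpha$ in this common spectrum, $$\dim\ker\bigl(A_i-\tau_i^{-1}\alpha I\bigr)=\dim\ker\bigl(A_j-\tau_j^{-1}\alpha I\bigr)\qquad\text{for all } i,j\in I.$$ Moreover, when all eigenvalues of every $A_i$ are simple, condition (ii) reduces to the existence of positive scalars $\{\tau_i\}_{i\in I}$ with $\sigma(\tau_iA_i)=\sigma(\tau_jA_j)$ for all $i,j\in I$.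
   Context: Hilbert spaces are complex. ''Positive'' means $\langle A_iu,u\rangle\ge0$ for all $u\in\mathrm{Dom}(A_i)$. $I$ is an index set. *)

(* Defs.v *)
From HB Require Import structures.
From mathcomp Require Import all_boot all_order all_algebra sesquilinear.
From mathcomp Require Import complex.
From mathcomp Require Import all_classical all_reals all_analysis.

Set Implicit Arguments.
Unset Strict Implicit.
Unset Printing Implicit Defensive.

Import Order.TTheory GRing.Theory Num.Theory.
Import numFieldNormedType.Exports.
Local Open Scope classical_set_scope.
Local Open Scope complex_scope.
Local Open Scope ring_scope.

(* [inner] is linear in its first argument and conjugate-linear in the second;
   the norm of a normed module over [R[i]] takes its values in [R[i]]. *)
HB.mixin Record isHilbert (R : realType) H of CompleteNormedModule R[i] H := {
  inner : {dot H for (@Num.conj R[i])} ;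
  inner_norm : forall u : H, inner u u = `|u| ^+ 2
}.

#[short(type="hilbertType")]
HB.structure Definition Hilbert (R : realType) :=
  {H of isHilbert R H & CompleteNormedModule R[i] H}.

Definition separable (T : topologicalType) : Prop :=
  exists D : set T, countable D /\ dense D.

Section Bounded.
Context {R : realType}.

Definition bounded_op (G H : hilbertType R) (T : G -> H) : Prop :=
  exists M : R, forall u, `|T u| <= M%:C * `|u|.

Definition bounded_invertible (G H : hilbertType R) (T : {linear G -> H}) :=
  bounded_op T /\
  exists T' : {linear H -> G}, [/\ bounded_op T', cancel T T' & cancel T' T].

Definition compact_op (G H : hilbertType R) (T : G -> H) : Prop :=
  precompact (T @` [set u | `|u| <= 1]).

End Bounded.

(* A possibly unbounded linear operator: the values of [app] outside [dom] are
   irrelevant. *)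
Record operator (R : realType) (H : hilbertType R) := Operator {
  dom : set H ;
  app :> H -> H ;
  dom0 : dom 0 ;
  domP : forall (c : R[i]) u v, dom u -> dom v -> dom (c *: u + v) ;
  appP : forall (c : R[i]) u v, dom u -> dom v ->
    app (c *: u + v) = c *: app u + app v
}.

Section Operators.
Context {R : realType} {H : hilbertType R}.
Implicit Types (A : operator H) (z c : R[i]).

Fact scale_op_subproof c A (a : R[i]) u v : dom A u -> dom A v ->
  c *: A (a *: u + v) = a *: (c *: A u) + c *: A v.
Proof. by move=> Au Av; rewrite appP// scalerDr !scalerA mulrC. Qed.

Definition scale_op c A : operator H :=
  Operator (dom0 A) (@domP _ _ A) (@scale_op_subproof c A).

Fact shift_op_subproof A z (a : R[i]) u v : dom A u -> dom A v ->
  A (a *: u + v) - z *: (a *: u + v) = a *: (A u - z *: u) + (A v - z *: v).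
Proof.
move=> Au Av; rewrite appP// scalerDr scalerBr opprD !scalerA (mulrC z).
by rewrite addrACA.
Qed.

(* A - z I *)
Definition shift_op A z : operator H :=
  Operator (dom0 A) (@domP _ _ A) (@shift_op_subproof A z).

Definition ker A : set H := [set u | dom A u /\ A u = 0].

(* v lies in the domain of the adjoint of A, which maps it to w (w is unique
   when A is densely defined). *)
Definition adjoint_graph A (v w : H) : Prop :=
  forall u, dom A u -> inner (A u) v = inner u w.

Definition self_adjoint A : Prop :=
  dense (dom A) /\
  forall v w, adjoint_graph A v w <-> dom A v /\ A v = w.

Definition positive_op A : Prop := forall u, dom A u -> 0 <= inner (A u) u.

Definition is_inverse A (T : H -> H) : Prop :=
  (forall v, dom A (T v) /\ A (T v) = v) /\ (forall u, dom A u -> T (A u) = u).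

Definition resolvent_set A : set R[i] :=
  [set z | exists T : {linear H -> H}, bounded_op T /\ is_inverse (shift_op A z) T].

Definition spectrum A : set R[i] := ~` resolvent_set A.

Definition compact_resolvent A : Prop :=
  exists z (T : {linear H -> H}),
    [/\ bounded_op T, is_inverse (shift_op A z) T & compact_op T].

(* T is the strongly continuous semigroup (e^{-tA})_{t >= 0}, i.e. the one whose
   infinitesimal generator is -A, with domain exactly [dom A]; the values T t
   for t < 0 are irrelevant. *)
Definition is_exp_semigroup A (T : R -> {linear H -> H}) : Prop :=
  [/\ forall t, 0 <= t -> bounded_op (T t),
      forall u, T 0 u = u,
      forall s t u, 0 <= s -> 0 <= t -> T (s + t) u = T s (T t u),
      forall u, T t u @[t --> 0^'+] --> u &
      forall u v, (dom A u /\ A u = v) <->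
        (t%:C^-1 *: (T t u - u) @[t --> 0^'+] --> - v)].

Definition is_basis (W : set H) n (b : 'I_n -> H) : Prop :=
  [/\ forall k, W (b k),
      forall c : 'I_n -> R[i],
        \sum_(k < n) c k *: b k = 0 -> forall k, c k = 0 &
      forall w, W w -> exists c : 'I_n -> R[i], w = \sum_(k < n) c k *: b k].

(* [Some n] for a subspace of finite dimension n, [None] for an
   infinite-dimensional one. *)
Definition dim (W : set H) : option nat :=
  xget None [set Some n | n in [set n | exists b : 'I_n -> H, is_basis W b]].

Definition eigenvalue_op A (a : R[i]) : Prop :=
  exists u, [/\ u != 0, dom A u & A u = a *: u].

Definition simple_eigenvalues A : Prop :=
  forall a, eigenvalue_op A a -> dim (ker (shift_op A a)) = Some 1%N.

End Operators.

Section Families.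
Context {R : realType} {I : Type} {H : I -> hilbertType R}.

Definition intertwined (S : forall i, R -> {linear H i -> H i}) (tau : I -> R)
    (K : forall i j, {linear H j -> H i}) : Prop :=
  [/\ forall i j, bounded_invertible (K i j),
      forall i j k u, K i k u = K i j (K j k u) &
      forall i j t u, 0 <= t ->
        K i j (S j t u) = S i (tau i / tau j * t) (K i j u)].

Definition same_spectra (A : forall i, operator (H i)) (tau : I -> R) : Prop :=
  forall i j,
    spectrum (scale_op (tau i)%:C (A i)) = spectrum (scale_op (tau j)%:C (A j)).

Definition same_multiplicities (A : forall i, operator (H i)) (tau : I -> R) :=
  forall i j (a : R[i]), spectrum (scale_op (tau i)%:C (A i)) a ->
    dim (ker (shift_op (A i) ((tau i)%:C^-1 * a))) =
    dim (ker (shift_op (A j) ((tau j)%:C^-1 * a))).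

End Families.

(* Main.v *)
Require Import Defs.
From HB Require Import structures.
From mathcomp Require Import all_boot all_order all_algebra sesquilinear.
From mathcomp Require Import complex.
From mathcomp Require Import all_classical all_reals all_analysis.
From mathcomp Require Import ring lra.

Set Implicit Arguments.
Unset Strict Implicit.
Unset Printing Implicit Defensive.

Import Order.TTheory GRing.Theory Num.Theory.
Import numFieldNormedType.Exports.
Local Open Scope classical_set_scope.
Local Open Scope complex_scope.
Local Open Scope ring_scope.

(* (i) => (ii): [K i j] conjugates [tau_j A_j] to [tau_i A_i], because it maps the
   difference quotients of [S_j] to rescaled difference quotients of [S_i]; it
   hence transports resolvents and eigenspaces.

   (ii) => (i): since [A_i + 1] has a compact inverse, the eigenvectors of [A_i]
   are total, and its eigenspaces are finite dimensional.  Equal multiplicities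
   give, for each [i], an orthonormal eigenbasis [e_(i,m)] of [tau_i A_i], indexed
   by the same set for all [i] and with the same eigenvalues, and [K i j] is the
   unitary map sending each [e_(j,m)] to [e_(i,m)].  It intertwines the semigroups
   because [S_i t] acts as [exp (- a t)] on [ker (A_i - a)]: that space is finite
   dimensional and invariant, so [exp (a h) S_i h = 1 + o(h)] there in operator
   norm, and the [n]-th powers at [h = t / n] tend to the identity.

   For simple eigenvalues all multiplicities are 1, as the spectrum consists of
   eigenvalues. *)

(** * Norms and inner products *)

Section RealNorm.
Context {R : realType}.

(* [R[i]] is only partially ordered, so norms are read off in [R]. *)
Definition hnorm (V : normedZmodType R[i]) (v : V) : R := complex.Re `|v|.

Section Theory.
Context {V : normedZmodType R[i]}.
Implicit Types u v : V.

Lemma normE u : `|u| = (hnorm u)%:C.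
Proof. by rewrite RRe_real// normr_real. Qed.

Lemma hnorm_ge0 u : 0 <= hnorm u.
Proof. by rewrite -ler0c -normE. Qed.

Lemma hnorm0 : hnorm (0 : V) = 0.
Proof. by rewrite /hnorm normr0. Qed.

Lemma hnorm_eq0 u : (hnorm u == 0) = (u == 0).
Proof. by rewrite -(normr_eq0 u) (normE u) -(inj_eq (@complexI R)). Qed.

Lemma hnorm_gt0 u : (0 < hnorm u) = (u != 0).
Proof. by rewrite lt_def hnorm_ge0 andbT hnorm_eq0. Qed.

Lemma hnormN u : hnorm (- u) = hnorm u.
Proof. by rewrite /hnorm normrN. Qed.

Lemma hnormB u v : hnorm (u - v) = hnorm (v - u).
Proof. by rewrite -hnormN opprB. Qed.

Lemma ler_hnormD u v : hnorm (u + v) <= hnorm u + hnorm v.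
Proof. by rewrite -lecR rmorphD/= -!normE ler_normD. Qed.

Lemma ler_hnormB u v : hnorm (u - v) <= hnorm u + hnorm v.
Proof. by rewrite -(hnormN v) ler_hnormD. Qed.

Lemma ler_hdistD w u v : hnorm (u - v) <= hnorm (u - w) + hnorm (w - v).
Proof. by rewrite -[u - v](subrKA w) ler_hnormD. Qed.

Lemma hnorm_small u : (forall e : R, 0 < e -> hnorm u < e) -> u = 0.
Proof.
move=> h; apply/eqP; rewrite -hnorm_eq0 eq_le hnorm_ge0 andbT leNgt.
by apply/negP => /h; rewrite ltxx.
Qed.

Lemma ler_hnorm_sum (I : Type) (r : seq I) (P : pred I) (F : I -> V) :
  hnorm (\sum_(k <- r | P k) F k) <= \sum_(k <- r | P k) hnorm (F k).
Proof.
elim/big_ind2: _ => [|x y z t h1 h2|//]; first by rewrite hnorm0.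
by rewrite (le_trans (ler_hnormD _ _))// lerD.
Qed.

End Theory.

Lemma hnormM (a b : R[i]) : hnorm (a * b) = hnorm a * hnorm b.
Proof. by apply: complexI; rewrite rmorphM/= -!normE normrM. Qed.

Lemma hnormC (a : R) : hnorm a%:C = `|a|.
Proof. by rewrite /hnorm normc_def/= expr0n addr0 sqrtr_sqr. Qed.

Lemma hnormZ (V : normedModType R[i]) (a : R[i]) (u : V) :
  hnorm (a *: u) = hnorm a * hnorm u.
Proof. by apply: complexI; rewrite rmorphM/= -!normE normrZ. Qed.

Lemma ReD (a b : R[i]) : complex.Re (a + b) = complex.Re a + complex.Re b.
Proof. by rewrite raddfD. Qed.

(** The library quantifies over [0 < e] in [R[i]]. Positivity there forces [e] to be real, so real
    tolerances suffice. *)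
Lemma hnorm_cvgP (T : Type) (F : set_system T) (FF : Filter F)
    (V : normedModType R[i]) (f : T -> V) (l : V) :
  f @ F --> l <-> forall e : R, 0 < e -> \forall t \near F, hnorm (l - f t) < e.
Proof.
split.
  move=> /cvgrPdist_lt fl e e0.
  have e0' : 0 < e%:C by rewrite ltcR.
  by have := fl _ e0'; apply: filterS => t; rewrite normE ltcR.
move=> fl; apply/cvgrPdist_lt => e e0.
have eE : e = (complex.Re e)%:C by rewrite RRe_real// gtr0_real.
have : 0 < complex.Re e by rewrite -ltcR -eE.
by move=> /fl; apply: filterS => t ?; rewrite normE eE ltcR.
Qed.

Lemma hnorm_complete (V : completeNormedModType R[i]) (u : nat -> V) :
  (forall e : R, 0 < e -> exists N, forall n m, (N <= n)%N -> (N <= m)%N ->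
     hnorm (u n - u m) < e) ->
  exists l, forall e : R, 0 < e -> exists N, forall n, (N <= n)%N ->
    hnorm (l - u n) < e.
Proof.
move=> uC.
have /cauchy_cvg : cauchy (u @ \oo).
  apply: cauchy_exP => e e0.
  have eE : e = (complex.Re e)%:C by rewrite RRe_real// gtr0_real.
  have /uC[N uN] : 0 < complex.Re e by rewrite -ltcR -eE.
  exists (u N); exists N => // n /= Nn.
  by rewrite -ball_normE /= normE eE ltcR uN.
move=> /cvg_ex[l /hnorm_cvgP ul]; exists l => e /ul[N _ uN].
by exists N => n Nn; exact: uN.
Qed.

Lemma hnorm_nbhs (V : normedModType R[i]) (v : V) (e : R) : 0 < e ->
  nbhs v [set w | hnorm (v - w) < e].
Proof.
move=> e0; have e0' : 0 < e%:C by rewrite ltcR.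
have := nbhsx_ballx v _ e0'; apply: filterS => w.
by rewrite -ball_normE /= normE ltcR.
Qed.

End RealNorm.

Section Inner.
Context {R : realType} {H : hilbertType R}.
Implicit Types (u v w : H) (a : R[i]).

Lemma innerDl u v w : inner (u + v) w = inner u w + inner v w.
Proof. exact: linearDl. Qed.

Lemma innerBl u v w : inner (u - v) w = inner u w - inner v w.
Proof. exact: linearBl. Qed.

Lemma innerZl a u v : inner (a *: u) v = a * inner u v.
Proof. exact: linearZl_LR. Qed.

Lemma inner0l u : inner (0 : H) u = 0.
Proof. exact: linear0l. Qed.

Lemma innerJ u v : inner u v = Num.conj (inner v u).
Proof. by rewrite (@hermC _ _ _ _ (@inner R H)) expr0 mul1r. Qed.

Lemma innerDr u v w : inner w (u + v) = inner w u + inner w v.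
Proof. exact: linearDr. Qed.

Lemma innerZr a u v : inner u (a *: v) = Num.conj a * inner u v.
Proof. exact: linearZr_LR. Qed.

Lemma inner0r u : inner u (0 : H) = 0.
Proof. exact: linear0r. Qed.

Lemma innerC0 u v : inner u v = 0 -> inner v u = 0.
Proof. by move=> uv; rewrite innerJ uv rmorph0. Qed.

Lemma inner_suml (I : Type) (r : seq I) (P : pred I) (F : I -> H) u :
  inner (\sum_(k <- r | P k) F k) u = \sum_(k <- r | P k) inner (F k) u.
Proof. exact: linear_sumlz. Qed.

Lemma hnorm_inner u : inner u u = (hnorm u ^+ 2)%:C.
Proof. by rewrite inner_norm normE rmorphXn. Qed.

Lemma Re_conj a : complex.Re (Num.conj a) = complex.Re a.
Proof.
(* Here [Re_conj] is still the library lemma about the [R[i]]-valued real part; the result is pulled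
   back along the embedding of [R]. *)
by have := complexRe (Num.conj a); rewrite Re_conj -complexRe => /complexI.
Qed.

Lemma sqr_hnormD u v :
  hnorm (u + v) ^+ 2 = hnorm u ^+ 2 + hnorm v ^+ 2 + 2 * complex.Re (inner u v).
Proof.
have sq w : hnorm w ^+ 2 = complex.Re (inner w w) by rewrite hnorm_inner.
rewrite !sq innerDl !innerDr !ReD (innerJ v u) Re_conj.
by ring.
Qed.

Lemma sqr_hnormB u v :
  hnorm (u - v) ^+ 2 = hnorm u ^+ 2 + hnorm v ^+ 2 - 2 * complex.Re (inner u v).
Proof.
rewrite sqr_hnormD hnormN -scaleN1r innerZr rmorphN1 mulN1r raddfN/=.
by rewrite mulrN.
Qed.

Lemma conj_real_complex (t : R) : Num.conj t%:C = t%:C.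
Proof. by rewrite conj_Creal//; apply/complex_realP; exists t. Qed.

Lemma sqr_conjM a : a * Num.conj a = (hnorm a ^+ 2)%:C.
Proof. by rewrite -normCK normE rmorphXn. Qed.

Lemma Cauchy_Schwarz u v : hnorm (inner u v) <= hnorm u * hnorm v.
Proof.
have [->|v0] := eqVneq v 0; first by rewrite inner0r !hnorm0 mulr0.
have nv : 0 < hnorm v by rewrite hnorm_gt0.
(* The residual of projecting [u] on [v], scaled by [|v|^2] to avoid division; its squared norm is
   [|v|^2 (|u|^2 |v|^2 - |<u, v>|^2)]. *)
have := sqr_hnormB (((hnorm v ^+ 2)%:C) *: u) (inner u v *: v).
rewrite innerZl innerZr [Num.conj _ * _]mulrC sqr_conjM.
rewrite !hnormZ hnormC (ger0_norm (sqr_ge0 _)) -rmorphM/= => e.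
have : 0 <= hnorm v ^+ 2 * ((hnorm u * hnorm v) ^+ 2 - hnorm (inner u v) ^+ 2).
  have := sqr_ge0 (hnorm ((hnorm v ^+ 2)%:C *: u - inner u v *: v)).
  by rewrite e => /le_trans; apply; rewrite le_eqVlt; apply/orP; left;
     apply/eqP; ring.
rewrite pmulr_rge0 ?exprn_gt0// subr_ge0 ler_pXn2r// ?nnegrE ?hnorm_ge0//.
by rewrite mulr_ge0 ?hnorm_ge0.
Qed.

End Inner.

(** * Closed subspaces *)

(** By Cauchy-Schwarz, replacing [u], [v] by [u'], [v'] costs at most a multiple of [|x| + |y|].
    This is the common source of closedness for orthogonal complements, self-adjoint operators and
    graphs of isometries. *)
Lemma inner_eq_adherent {R : realType} {G H : hilbertType R}
    (u x : G) (v y : H) :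
  (forall e : R, 0 < e -> exists u' v',
     [/\ hnorm (u - u') < e, hnorm (v - v') < e & inner v' y = inner u' x]) ->
  inner v y = inner u x.
Proof.
move=> uv; apply/eqP; rewrite -subr_eq0; apply/eqP; apply: hnorm_small => e e0.
pose k := hnorm y + hnorm x + 1.
have k0 : 0 < k by rewrite ltr_wpDl// addr_ge0 ?hnorm_ge0.
have [u' [v' [uu' vv' E]]] := uv _ (divr_gt0 e0 k0).
have -> : inner v y - inner u x = inner (v - v') y - inner (u - u') x.
  by rewrite !innerBl E opprB addrA subrK.
rewrite (le_lt_trans (ler_hnormB _ _))//.
apply: le_lt_trans (lerD (Cauchy_Schwarz _ _) (Cauchy_Schwarz _ _)) _.
apply: (@le_lt_trans _ _ (e / k * (hnorm y + hnorm x))).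
  by rewrite mulrDr lerD// ler_wpM2r ?hnorm_ge0// ltW.
by rewrite mulrAC ltr_pdivrMr// ltr_pM2l// /k ltrDl ltr01.
Qed.

Section Subspaces.
Context {R : realType} {H : hilbertType R}.
Implicit Types (u v w : H) (W : set H).

Definition closed_subspace W :=
  [/\ W 0, forall (c : R[i]) u v, W u -> W v -> W (c *: u + v) &
      forall u, (forall e : R, 0 < e -> exists2 v, W v & hnorm (u - v) < e) ->
        W u].

Lemma closed_subspaceZ W c u : closed_subspace W -> W u -> W (c *: u).
Proof. by move=> [W0 Wl _] Wu; rewrite -[_ *: _]addr0; exact: Wl. Qed.

Lemma closed_subspaceD W u v : closed_subspace W -> W u -> W v -> W (u + v).
Proof. by move=> [_ Wl _] Wu Wv; rewrite -[u]scale1r; exact: Wl. Qed.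

Lemma closed_subspace_sum W (I : Type) (r : seq I) (P : pred I) (F : I -> H) :
  closed_subspace W -> (forall k, W (F k)) -> W (\sum_(k <- r | P k) F k).
Proof.
move=> Wc WF; elim/big_ind: _ => [|u v|k _]; first by case: Wc.
- exact: closed_subspaceD.
- exact: WF.
Qed.

Lemma orthogonal_closed (E : set H) :
  closed_subspace [set u | forall w, E w -> inner u w = 0].
Proof.
split=> [w _|c u v Wu Wv w Ew|u uW w Ew]; first exact: inner0l.
- by rewrite innerDl innerZl Wu// Wv// mulr0 addr0.
- rewrite -(inner0l w); apply: inner_eq_adherent => e e0.
  have [v Wv uv] := uW e e0; exists 0, v.
  by rewrite subrr hnorm0 inner0l Wv.
Qed.

Lemma invS_lt (e : R) : 0 < e ->
  exists N, forall n, (N <= n)%N -> n.+1%:R^-1 < e.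
Proof.
move=> e0; have [N _ eN] := near_infty_natSinv_lt (PosNum e0).
by exists N => n Nn; exact: eN.
Qed.

(** Parallelogram identity: [|u - v|^2 = 2 |u|^2 + 2 |v|^2 - |u + v|^2], which is at most
    [4 (d + r)^2 - 4 d^2]. It makes minimising sequences Cauchy. *)
Lemma ler_parallelogram (d r : R) u v :
  hnorm u <= d + r -> hnorm v <= d + r -> d <= hnorm (2^-1 *: (u + v)) ->
  0 <= d -> 0 <= r ->
  hnorm (u - v) ^+ 2 <= 8 * d * r + 4 * r ^+ 2.
Proof.
move=> ur vr; rewrite hnormZ => duv d0 r0.
have h2 : hnorm (2^-1 : R[i]) = 2^-1.
  have -> : (2^-1 : R[i]) = (2^-1)%:C by rewrite fmorphV rmorph_nat.
  by rewrite hnormC ger0_norm// invr_ge0.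
rewrite h2 in duv.
have hu : hnorm u ^+ 2 <= (d + r) ^+ 2.
  by rewrite ler_pXn2r// nnegrE ?hnorm_ge0// addr_ge0.
have hv : hnorm v ^+ 2 <= (d + r) ^+ 2.
  by rewrite ler_pXn2r// nnegrE ?hnorm_ge0// addr_ge0.
have huv : (2 * d) ^+ 2 <= hnorm (u + v) ^+ 2.
  rewrite ler_pXn2r// ?nnegrE ?hnorm_ge0// ?mulr_ge0//.
  by move: duv; lra.
rewrite sqr_hnormB; rewrite sqr_hnormD in huv.
by move: hu hv huv; nra.
Qed.

(** A sequence in [W] minimising the distance to [x] is Cauchy, because midpoints stay in [W]; its
    limit attains the infimum. *)
Lemma closed_nearest W x : closed_subspace W ->
  exists2 p, W p & forall w, W w -> hnorm (x - p) <= hnorm (x - w).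
Proof.
move=> [W0 Wl Wc].
pose D := [set hnorm (x - w) | w in W].
have Dlb : lbound D 0 by move=> _ [w _ <-]; exact: hnorm_ge0.
have Di : has_inf D by split; [exists (hnorm (x - 0)); exists 0|exists 0].
have d0 : 0 <= inf D by apply: lb_le_inf => //; case: Di.
have dP w : W w -> inf D <= hnorm (x - w).
  by move=> Ww; apply: ge_inf; [exists 0|exists w].
have /choice[w wP] n : exists w, W w /\ hnorm (x - w) < inf D + n.+1%:R^-1.
  have [|_ [w Ww <-] h] := @inf_adherent _ D n.+1%:R^-1 _ Di.
    by rewrite invr_gt0.
  by exists w.
have [|p pP] := @hnorm_complete _ _ w.
  (* With [r = 1 / (N + 1) <= 1], the parallelogram bound [8 d r + 4 r^2] is at most [(8 d + 4) r],
     hence below [e^2]. *)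
  move=> e e0; have f0 : 0 < e ^+ 2 / (8 * inf D + 4).
    by rewrite divr_gt0 ?exprn_gt0// ltr_wpDl// mulr_ge0.
  have [N NP] := invS_lt f0; exists N => n m Nn Nm.
  have rn : n.+1%:R^-1 <= N.+1%:R^-1 :> R by rewrite lef_pV2 ?posrE// ler_nat.
  have rm : m.+1%:R^-1 <= N.+1%:R^-1 :> R by rewrite lef_pV2 ?posrE// ler_nat.
  have r0 : 0 < N.+1%:R^-1 :> R by rewrite invr_gt0.
  have r1 : N.+1%:R^-1 <= 1 :> R by rewrite invf_le1// ler1n.
  have rN := NP N (leqnn N); rewrite ltr_pdivlMr in rN; last first.
    by rewrite ltr_wpDl// mulr_ge0.
  have [Wn wn] := wP n; have [Wm wm] := wP m.
  rewrite -(@ltr_pXn2r _ 2)// ?nnegrE ?hnorm_ge0// ?(ltW e0)//.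
  have -> : w n - w m = (x - w m) - (x - w n).
    by rewrite opprB [RHS]addrC addrA subrK.
  apply: (@le_lt_trans _ _ (8 * inf D * N.+1%:R^-1 + 4 * N.+1%:R^-1 ^+ 2)).
    apply: ler_parallelogram => //.
    - by rewrite (le_trans (ltW wm))// lerD2l.
    - by rewrite (le_trans (ltW wn))// lerD2l.
    - have -> : 2^-1 *: (x - w m + (x - w n)) = x - 2^-1 *: (w m + w n).
        rewrite addrACA -opprD scalerBr -mulr2n -(scaler_nat 2 x) scalerA.
        by rewrite mulVf ?scale1r// pnatr_eq0.
      apply: dP; rewrite scalerDr; apply: (Wl) => //.
      by rewrite -[_ *: _]addr0; exact: Wl.
  have r2 : N.+1%:R^-1 ^+ 2 <= N.+1%:R^-1 :> R by rewrite expr2 ger_pMl.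
  apply: le_lt_trans rN; rewrite mulrDr.
  by move: (N.+1%:R^-1) r2 => r; lra.
exists p.
  apply: Wc => e /pP[N NP]; exists (w N); first by case: (wP N).
  exact: NP.
move=> v Wv; apply: le_trans (dP _ Wv); apply/ler_addgt0Pr => e e0.
have e2 : 0 < e / 2 by rewrite divr_gt0.
have [N NP] := pP _ e2; have [M MP] := invS_lt e2.
have pn := NP (maxn N M) (leq_maxl _ _).
have rn := MP (maxn N M) (leq_maxr _ _).
have [_ wn] := wP (maxn N M).
rewrite (le_trans (ler_hdistD (w (maxn N M)) _ _))//.
rewrite hnormB in pn; move: pn rn wn; move: ((maxn N M).+1%:R^-1) => r; lra.
Qed.

(** Moving [p] by [t b w] with [b = <x - p, w>] cannot bring it closer to [x]; expanding the square
    gives [2 |b|^2 <= t |b|^2 |w|^2 <= |b|^2], so [b = 0]. *)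
Lemma nearest_orthogonal W x p : closed_subspace W -> W p ->
  (forall w, W w -> hnorm (x - p) <= hnorm (x - w)) ->
  forall w, W w -> inner (x - p) w = 0.
Proof.
move=> Wc Wp pP w Ww; set y := x - p; set b := inner y w.
pose q := hnorm w ^+ 2; pose k := hnorm b ^+ 2.
have q0 : 0 <= q by exact: sqr_ge0.
have k0 : 0 <= k by exact: sqr_ge0.
(* The [+ 1] gives [t * q <= 1] even when [w = 0]. *)
pose t : R := (q + 1)^-1.
have t0 : 0 < t by rewrite invr_gt0 ltr_wpDl.
have tq : t * q <= 1.
  by rewrite mulrC ler_pdivrMr ?mul1r ?lerDl// ltr_wpDl.
have : hnorm y ^+ 2 <= hnorm (y - (t%:C * b) *: w) ^+ 2.
  rewrite ler_pXn2r// ?nnegrE ?hnorm_ge0// /y -addrA -opprD.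
  apply: pP; apply: closed_subspaceD => //; exact: closed_subspaceZ.
rewrite (sqr_hnormB y) innerZr rmorphM/= -/b -mulrA.
rewrite [Num.conj b * b]mulrC sqr_conjM.
rewrite hnormZ hnormM hnormC gtr0_norm//.
rewrite conj_real_complex -rmorphM/= !exprMn -/q -/k => h.
have kk : k <= 0.
  have : 2 * k <= t * k * q.
    rewrite -(@ler_pM2l _ t)//; move: h; set z := hnorm y ^+ 2.
    have -> : t ^+ 2 * k * q = t * (t * k * q) by ring.
    by lra.
  have : t * k * q <= k.
    have -> : t * k * q = (t * q) * k by ring.
    by rewrite ler_piMl.
  by lra.
have : k = 0 by apply/eqP; rewrite eq_le kk.
by move/eqP; rewrite sqrf_eq0 hnorm_eq0 => /eqP.
Qed.

Lemma closed_subspace_total W : closed_subspace W ->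
  (forall u, (forall w, W w -> inner u w = 0) -> u = 0) -> forall u, W u.
Proof.
move=> Wc W0 u; have [p Wp pP] := closed_nearest u Wc.
have /W0/eqP := nearest_orthogonal Wc Wp pP.
by rewrite subr_eq0 => /eqP ->.
Qed.

End Subspaces.

(** * Boundedness and sequential compactness of operators *)

Section SequentiallyCompact.
Context {R : realType} {G H : hilbertType R}.

Lemma bounded_opP (T : G -> H) : bounded_op T <->
  exists2 M : R, 0 < M & forall u, hnorm (T u) <= M * hnorm u.
Proof.
split=> [[M TM]|[M M0 TM]]; last first.
  by exists M => u; rewrite !normE -rmorphM lecR.
exists (`|M| + 1) => [|u]; first by rewrite ltr_wpDl.
have := TM u; rewrite !normE -rmorphM lecR => /le_trans; apply.
by rewrite ler_wpM2r ?hnorm_ge0// ler_wpDr// ler_norm.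
Qed.

(** Here [v] is a cluster point of the images; arbitrarily late good indices replace the extraction
    of a subsequence. *)
Definition seq_compact_op (T : G -> H) : Prop :=
  forall (u : nat -> G) (M : R), (forall n, hnorm (u n) <= M) ->
  exists v, forall (e : R) N, 0 < e ->
    exists2 n, (N <= n)%N & hnorm (v - T (u n)) < e.

(** Dividing by [|M| + 1] puts the sequence in the unit ball, whose image lies in a compact set; a
    cluster point there is scaled back. *)
Lemma compact_op_seq (T : {linear G -> H}) : compact_op T -> seq_compact_op T.
Proof.
move=> [U TU [Ucpt _]] u M uM.
have m0 : 0 < `|M| + 1 by rewrite ltr_wpDl.
set m := `|M| + 1 in m0.
pose w n := (m^-1)%:C *: u n.
have mC : (m^-1)%:C * m%:C = 1 :> R[i].
  by rewrite -rmorphM/= mulVf ?rmorph1// gt_eqF.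
have wU n : U (T (w n)).
  apply: TU; exists (w n) => //=.
  rewrite normE -[1]/(1%:C) lecR hnormZ hnormC gtr0_norm ?invr_gt0//.
  rewrite mulrC ler_pdivrMr// mul1r (le_trans (uM n))//.
  by rewrite ler_wpDr// ler_norm.
have [|v [_ vc]] := Ucpt (T \o w @ \oo) _.
  by exists 0 => // n _; exact: wU.
exists (m%:C *: v) => e N e0.
have [||_ [[n Nn <-] vn]] := vc (T @` (w @` [set n | (N <= n)%N]))
  [set z | hnorm (v - z) < e / m].
- by exists N => // n Nn; exists (w n) => //; exists n.
- by apply: hnorm_nbhs; rewrite divr_gt0.
case: Nn vn => k Nk <- /= vn; exists k => //.
have -> : T (u k) = m%:C *: T (w k).
  by rewrite linearZ/= scalerA mulrC mC scale1r.
by rewrite -scalerBr hnormZ hnormC gtr0_norm// mulrC -ltr_pdivlMr.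
Qed.

End SequentiallyCompact.

(** * Self-adjoint operators *)

(** Single-valuedness forces the chosen function to be linear. Resolvents and isometries are both
    built this way, from their graphs. *)
Lemma linear_choice (K : pzRingType) (U V : lmodType K) (P : U -> V -> Prop) :
  (forall u, exists v, P u v) ->
  (forall c u u' v v', P u v -> P u' v' -> P (c *: u + u') (c *: v + v')) ->
  (forall u v v', P u v -> P u v' -> v = v') ->
  exists T : {linear U -> V}, forall u, P u (T u).
Proof.
move=> /choice[f fP] Pl Pu.
have f_lin : linear f by move=> c u v; apply: Pu (fP _) _; exact: Pl.
pose T : {linear U -> V} := HB.pack f (GRing.isLinear.Build _ _ _ _ f f_lin).
by exists T.
Qed.

Section OperatorAlgebra.
Context {R : realType} {H : hilbertType R}.
Implicit Types (A : operator H) (u v w : H) (a b c : R[i]).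

Lemma domZ A c u : dom A u -> dom A (c *: u).
Proof. by move=> Au; rewrite -[_ *: _]addr0; exact: domP Au (dom0 A). Qed.

Lemma app0 A : A 0 = 0.
Proof.
have := Defs.appP (-1) (dom0 A) (dom0 A).
by rewrite scaler0 addr0 scaleN1r addNr.
Qed.

Lemma appZ A c u : dom A u -> A (c *: u) = c *: A u.
Proof.
by move=> Au; rewrite -[c *: u]addr0 (Defs.appP _ Au (dom0 A)) app0 addr0.
Qed.

End OperatorAlgebra.

Section SelfAdjoint.
Context {R : realType} {H : hilbertType R} {A : operator H}.
Hypothesis Asa : self_adjoint A.
Implicit Types (u v w : H) (a b c : R[i]).

Lemma self_adjoint_sym u v : dom A u -> dom A v ->
  inner (A u) v = inner u (A v).
Proof. by move=> Au Av; have [_ /(_ v (A v))[_]] := Asa; apply. Qed.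

(** The graph of an adjoint is cut out by inner product identities, which survive limits, and [A] is
    its own adjoint. *)
Lemma self_adjoint_closed v w :
  (forall e : R, 0 < e ->
     exists u, [/\ dom A u, hnorm (v - u) < e & hnorm (w - A u) < e]) ->
  dom A v /\ A v = w.
Proof.
move=> vw; have [_ /(_ v w)[+ _]] := Asa; apply => u Au.
suff E : inner v (A u) = inner w u by rewrite innerJ E -innerJ.
apply: inner_eq_adherent => e /vw[u' [Au' vu' wu']]; exists (A u'), u'.
by split => //; rewrite self_adjoint_sym.
Qed.

Lemma eigen_inner a b u v : dom A u -> dom A v -> A u = a *: u ->
  A v = b *: v -> a * inner u v = Num.conj b * inner u v.
Proof.
by move=> Au Av ua vb; rewrite -innerZl -innerZr -ua -vb self_adjoint_sym.
Qed.

Lemma eigenvalue_real a : eigenvalue_op A a -> Num.conj a = a.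
Proof.
move=> [u [u0 Au ua]]; have /eqP := eigen_inner Au Au ua ua.
rewrite -subr_eq0 -mulrBl mulf_eq0 subr_eq0 => /orP[/eqP//|].
rewrite hnorm_inner fmorph_eq0 sqrf_eq0 hnorm_eq0.
by rewrite (negPf u0).
Qed.

Lemma eigen_orthogonal a b u v : dom A u -> dom A v -> A u = a *: u ->
  A v = b *: v -> a != b -> inner u v = 0.
Proof.
move=> Au Av ua vb ab; have [->|v0] := eqVneq v 0; first exact: inner0r.
have bR : Num.conj b = b by apply: eigenvalue_real; exists v.
have /eqP := eigen_inner Au Av ua vb; rewrite bR -subr_eq0 -mulrBl mulf_eq0.
by rewrite subr_eq0 (negPf ab) => /eqP.
Qed.

(* The range of [A - a] is closed by the lower bound, and its orthogonal
   complement is the kernel of [A - a^*]. *)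
Lemma resolvent_set_bounded_below a (c : R) : 0 < c ->
  (forall u, dom A u -> c * hnorm u <= hnorm (A u - a *: u)) ->
  (forall v, dom A v -> A v = Num.conj a *: v -> v = 0) ->
  resolvent_set A a.
Proof.
move=> c0 lb ker0.
pose P v u := dom A u /\ A u - a *: u = v.
have Pl k v v' u u' : P v u -> P v' u' -> P (k *: v + v') (k *: u + u').
  move=> [Au <-] [Au' <-]; split; first exact: domP.
  exact: (@Defs.appP _ _ (shift_op A a)).
have P0 : P 0 0 by split; [exact: dom0|rewrite app0 scaler0 subr0].
have Pb v u : P v u -> hnorm u <= c^-1 * hnorm v.
  by move=> [Au <-]; rewrite mulrC ler_pdivlMr// mulrC lb.
have Pu2 v u u' : P v u -> P v u' -> u = u'.
  move=> Pu Pu'; have /Pb : P (-1 *: v + v) (-1 *: u + u') by exact: Pl.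
  rewrite !scaleN1r addNr hnorm0 mulr0 => h; apply/eqP.
  by rewrite eq_sym -subr_eq0 -hnorm_eq0 eq_le hnorm_ge0 addrC h.
have [|||T TP] := @linear_choice _ _ _ P.
- apply: closed_subspace_total => [|v vP]; last first.
    suff [Av va] : dom A v /\ A v = Num.conj a *: v by exact: ker0.
  have [_ /(_ v (Num.conj a *: v))[h _]] := Asa; apply h => u Au.
  apply/eqP; rewrite innerZr conjCK -innerZl -subr_eq0 -innerBl.
  by rewrite innerJ vP ?rmorph0//; exists u.
  (* Closedness of the range: preimages of approximants of [v] are Cauchy by the lower bound, and
     since [A] is closed their limit is a preimage of [v]. *)
  split=> [|k v v' [u Pu] [u' Pu']|v vP]; first by exists 0.
    by exists (k *: u + u'); exact: Pl.
  have /choice[f fP] (n : nat) : exists w : H * H,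
      P w.2 w.1 /\ hnorm (v - w.2) < n.+1%:R^-1.
    have [|w [u Pu] vw] := vP n.+1%:R^-1; first by rewrite invr_gt0.
    by exists (u, w).
  have [|u uP] := @hnorm_complete R H (fun n => (f n).1).
    move=> e e0; have ce : 0 < c * e / 2 by rewrite divr_gt0// mulr_gt0.
    have [N NP] := invS_lt ce.
    exists N => n m Nn Nm; have [Pn vn] := fP n; have [Pm vm] := fP m.
    have := NP _ Nn; have := NP _ Nm; move: (n.+1%:R^-1) (m.+1%:R^-1) vn vm.
    move=> rn rm vn vm hm hn.
    have : P (-1 *: (f m).2 + (f n).2) (-1 *: (f m).1 + (f n).1) by exact: Pl.
    move=> /Pb; rewrite !scaleN1r ![- _ + _]addrC => /le_lt_trans; apply.
    rewrite mulrC ltr_pdivrMr// (le_lt_trans (ler_hdistD v _ _))//.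
    by rewrite hnormB; lra.
  exists u; suff [Au uv] : dom A u /\ A u = v + a *: u.
    by split => //; rewrite uv addrK.
  apply: self_adjoint_closed => e e0; pose k := hnorm a + 2.
  have k0 : 0 < k by rewrite ltr_wpDl// hnorm_ge0.
  have [N NP] := uP _ (divr_gt0 e0 k0); have [M MP] := invS_lt (divr_gt0 e0 k0).
  pose n := maxn N M; have := NP n (leq_maxl _ _); have := MP n (leq_maxr _ _).
  have [[Af Afv] fn] := fP n; move: (n.+1%:R^-1) fn => r fn re ue.
  have ke : e / k * k = e by rewrite divfK// gt_eqF.
  have ek : e / k <= e.
    by rewrite ler_pdivrMr// ler_peMr ?(ltW e0)// /k; have := hnorm_ge0 a; lra.
  exists (f n).1; split => //; first exact: lt_le_trans ek.
  have -> : v + a *: u - A (f n).1 = (v - (f n).2) + a *: (u - (f n).1).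
    by rewrite -Afv scalerBr opprD opprK [RHS]addrACA addrK.
  rewrite (le_lt_trans (ler_hnormD _ _))// hnormZ.
  have : hnorm a * hnorm (u - (f n).1) <= hnorm a * (e / k).
    by rewrite ler_wpM2l ?hnorm_ge0// ltW.
  by move: ke; rewrite /k mulrDr; have := divr_gt0 e0 k0; rewrite -/k; lra.
- exact: Pl.
- exact: Pu2.
exists T; split.
  by apply/bounded_opP; exists c^-1; rewrite ?invr_gt0// => u; exact: Pb.
split=> [v|u Au]; first exact: TP.
by apply: Pu2 (TP _) _; split.
Qed.

End SelfAdjoint.

(** * Spectral theorem for compact resolvents *)

Section CompactEigenvector.
Context {R : realType} {H : hilbertType R} {T : {linear H -> H}}.
Hypotheses (T1 : forall u, hnorm (T u) <= hnorm u)
  (Tsym : forall u v, inner (T u) v = inner u (T v))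
  (Tpos : forall u, 0 <= inner (T u) u)
  (Tinj : forall u, T u = 0 -> u = 0)
  (Tcpt : seq_compact_op T).
Implicit Types (u v w : H).

(* A maximising sequence for [|T u|] on the unit ball of [N] satisfies
   [T^2 u_n - m^2 u_n --> 0]; compactness turns it into an eigenvector of [T^2],
   and [T + m] is injective by positivity. *)
Lemma compact_eigenvector (N : set H) u0 : closed_subspace N ->
  (forall u, N u -> N (T u)) -> N u0 -> u0 != 0 ->
  exists (m : R) w, [/\ 0 < m, N w, w != 0 & T w = m%:C *: w].
Proof.
move=> Nc NT Nu0 u00.
pose D := [set hnorm (T u) | u in [set u | N u /\ hnorm u <= 1]].
have Dub : ubound D 1 by move=> _ [u [_ u1] <-]; exact: le_trans (T1 u) u1.
have D0 : D (hnorm (T 0)).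
  by exists 0 => //; split; [case: Nc | rewrite hnorm0 ler01].
have Ds : has_sup D by split; [exists (hnorm (T 0)) | exists 1].
pose m := sup D.
(* So [m] is the operator norm of [T] restricted to [N]. *)
have mP u : N u -> hnorm (T u) <= m * hnorm u.
  move=> Nu; have [->|u0'] := eqVneq u 0; first by rewrite linear0 hnorm0 mulr0.
  have hu : 0 < hnorm u by rewrite hnorm_gt0.
  rewrite -ler_pdivrMr// mulrC.
  have -> : (hnorm u)^-1 * hnorm (T u) = hnorm (T ((hnorm u)^-1%:C *: u)).
    by rewrite linearZ/= hnormZ hnormC ger0_norm// invr_ge0 ltW.
  apply: ub_le_sup; first by exists 1.
  exists ((hnorm u)^-1%:C *: u) => //; split; first exact: closed_subspaceZ.
  by rewrite hnormZ hnormC ger0_norm ?invr_ge0 ?(ltW hu)// mulVf ?lexx ?(gt_eqF hu).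
have m0 : 0 < m.
  have : 0 < m * hnorm u0.
    apply: lt_le_trans (mP _ Nu0); rewrite hnorm_gt0.
    by apply: contra u00 => /eqP/Tinj->.
  by rewrite pmulr_lgt0// hnorm_gt0.
have /choice[u uP] (n : nat) :
    exists u, [/\ N u, hnorm u <= 1 & m - n.+1%:R^-1 < hnorm (T u)].
  have [|_ [u [Nu u1] <-] h] := @sup_adherent _ D n.+1%:R^-1 _ Ds.
    by rewrite invr_gt0.
  by exists u.
have [v vP] := Tcpt (fun n => let: And3 _ h _ := uP n in h).
have Nv : N v.
  case: Nc => _ _; apply => e /(vP _ 0%N)[n _ vn]; exists (T (u n)) => //.
  by apply: NT; case: (uP n).
(* By symmetry the square is [|T T u|^2 + m^4 |u|^2 - 2 m^2 |T u|^2], at most [m^2 (m^2 - |T u|^2)],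
   and [|T u|] is within [1 / (n + 1)] of [m]. *)
have defect n : hnorm (T (T (u n)) - (m ^+ 2)%:C *: u n) ^+ 2 <=
    2 * m ^+ 3 * n.+1%:R^-1.
  have [Nu u1 mu] := uP n; move: (n.+1%:R^-1) mu => r mu.
  rewrite sqr_hnormB innerZr conj_real_complex Tsym hnorm_inner -rmorphM/=.
  rewrite hnormZ hnormC ger0_norm ?sqr_ge0//.
  have h1 := mP _ (NT _ Nu); have h2 := mP _ Nu.
  have a0 := hnorm_ge0 (T (T (u n))); have b0 := hnorm_ge0 (T (u n)).
  have c0 := hnorm_ge0 (u n).
  move: (hnorm _) (hnorm (T _)) (hnorm (u n)) u1 mu h1 h2 a0 b0 c0.
  move=> x y z z1 ry xy yz x0 y0 z0.
  have x2 : x ^+ 2 <= m ^+ 2 * y ^+ 2.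
    by rewrite -exprMn ler_pXn2r// nnegrE mulr_ge0// ltW.
  have z2 : z ^+ 2 <= 1 by rewrite exprn_ile1.
  have mz : (m ^+ 2 * z) ^+ 2 <= m ^+ 4.
    by rewrite exprMn -exprM ger_pMr// exprn_gt0.
  have ym : y <= m by apply: le_trans yz _; rewrite ger_pMr.
  have my : m ^+ 2 - y ^+ 2 <= 2 * m * r.
    have -> : m ^+ 2 - y ^+ 2 = (m - y) * (m + y) by ring.
    have r0 : 0 <= r by lra.
    have : (m - y) * (m + y) <= r * (m + m) by apply: ler_pM; lra.
    by lra.
  have : m ^+ 2 * (m ^+ 2 - y ^+ 2) <= m ^+ 2 * (2 * m * r).
    by rewrite ler_pM2l// exprn_gt0.
  move: x2 mz; have -> : m ^+ 4 = m ^+ 2 * m ^+ 2 by ring.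
  have -> : m ^+ 3 = m ^+ 2 * m by ring.
  by lra.
have TTv : T (T v) = (m ^+ 2)%:C *: v.
  apply/eqP; rewrite -subr_eq0; apply/eqP; apply: hnorm_small => e e0.
  (* Three errors are summed below, of sizes [e / k], [e / k] and [m^2 e / k]; [e1] makes the defect
     smaller than [e / k]. *)
  pose k := 2 + m ^+ 2; have k0 : 0 < k by rewrite ltr_wpDr ?sqr_ge0.
  have e1 : 0 < (e / k) ^+ 2 / (2 * m ^+ 3).
    by rewrite divr_gt0 ?exprn_gt0 ?divr_gt0// mulr_gt0// exprn_gt0.
  have [M MP] := invS_lt e1; have [n Mn vn] := vP (e / k) M (divr_gt0 e0 k0).
  have := MP n Mn; rewrite ltr_pdivlMr ?mulr_gt0 ?exprn_gt0// mulrC => h.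
  have {h} := le_lt_trans (defect n) h.
  rewrite ltr_pXn2r// ?nnegrE ?hnorm_ge0 ?divr_ge0 ?ltW// => h.
  have -> : T (T v) - (m ^+ 2)%:C *: v =
     T (T (v - T (u n))) + T (T (T (u n)) - (m ^+ 2)%:C *: u n)
       - (m ^+ 2)%:C *: (v - T (u n)).
    have -> : T (T (v - T (u n))) = T (T v) - T (T (T (u n))).
      by rewrite !linearB.
    have -> : T (T (T (u n)) - (m ^+ 2)%:C *: u n) =
        T (T (T (u n))) - (m ^+ 2)%:C *: T (u n) by rewrite linearB linearZ.
    by rewrite scalerBr opprB !subrKA.
  rewrite (le_lt_trans (ler_hnormB _ _))// hnormZ hnormC ger0_norm ?sqr_ge0//.
  have h1 := le_trans (T1 _) (T1 (v - T (u n))).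
  have h2 := T1 (T (T (u n)) - (m ^+ 2)%:C *: u n).
  have h3 := ler_hnormD (T (T (v - T (u n))))
    (T (T (T (u n)) - (m ^+ 2)%:C *: u n)).
  have h4 : m ^+ 2 * hnorm (v - T (u n)) <= m ^+ 2 * (e / k).
    by rewrite ler_wpM2l ?sqr_ge0// ltW.
  have : e / k * k = e by rewrite divfK// gt_eqF.
  by rewrite {2}/k mulrDr; lra.
(* The norms [|T u_n|] approach [m > 0], so their vectors cannot cluster at 0. *)
have v0 : v != 0.
  apply: contraTneq m0 => v0; rewrite -leNgt; apply/ler_addgt0Pr => e e0.
  have e2 : 0 < e / 2 by rewrite divr_gt0.
  have [M MP] := invS_lt e2; have [n Mn] := vP _ M e2.
  have [_ _] := uP n; have := MP n Mn; move: (n.+1%:R^-1) => r.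
  by rewrite v0 sub0r hnormN; lra.
exists m, v; split => //.
(* From [T (T v) = m^2 v] follows [T w = - m w], which positivity of [T] allows only for [w = 0]. *)
pose w := T v - m%:C *: v.
suff : w = 0 by move/eqP; rewrite subr_eq0 => /eqP.
have Tw : T w = - (m%:C *: w).
  rewrite /w linearB/= linearZ/= TTv scalerBr scalerA -rmorphM/= -expr2.
  by rewrite opprB.
apply/eqP; rewrite -hnorm_eq0 -sqrf_eq0 eq_le sqr_ge0 andbT.
have := Tpos w; rewrite Tw -scaleNr innerZl hnorm_inner -rmorphN -rmorphM/=.
by rewrite ler0c mulNr oppr_ge0 pmulr_rle0.
Qed.

End CompactEigenvector.

Section Spectral.
Context {R : realType} {H : hilbertType R} {A : operator H}.
Hypotheses (Asa : self_adjoint A) (Apos : positive_op A)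
  (Acpt : compact_resolvent A).
Implicit Types (u v w : H) (a b c : R[i]).

(** In the expansion of [|A u + u|^2] the cross term is nonnegative. The shape is that required by
    [resolvent_set_bounded_below] at the point [-1]. *)
Lemma positive_below u : dom A u -> 1 * hnorm u <= hnorm (A u - (-1) *: u).
Proof.
move=> Au; rewrite mul1r scaleN1r opprK.
rewrite -(@ler_pXn2r _ 2)// ?nnegrE ?hnorm_ge0// sqr_hnormD.
have : 0 <= complex.Re (inner (A u) u).
  by have := Apos Au; rewrite lecE => /andP[].
by have := sqr_ge0 (hnorm (A u)); lra.
Qed.

Lemma positive_ker_shift u : dom A u -> A u = - u -> u = 0.
Proof.
move=> Au uE; apply/eqP; rewrite -hnorm_eq0 -sqrf_eq0 eq_le sqr_ge0 andbT.
have := Apos Au; rewrite uE -scaleN1r innerZl hnorm_inner mulN1r -rmorphN/= ler0c.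
by rewrite oppr_ge0.
Qed.

(** The compact resolvent is given at some unknown [z]; it is moved to [-1], where positivity makes
    the inverse a contraction. *)
Lemma resolventN1 : exists T : {linear H -> H},
  [/\ forall v, dom A (T v) /\ A (T v) + T v = v,
      forall u, dom A u -> T (A u + u) = u,
      forall u, hnorm (T u) <= hnorm u & seq_compact_op T].
Proof.
have [|T [_ [T1 T2]]] := resolvent_set_bounded_below Asa ltr01 positive_below.
  move=> v Av vE; apply: positive_ker_shift => //.
  by rewrite vE rmorphN1 scaleN1r.
have {T1}T1 v : dom A (T v) /\ A (T v) + T v = v.
  by have [] := T1 v => /=; rewrite scaleN1r opprK.
have {T2}T2 u : dom A u -> T (A u + u) = u.
  by move=> /T2 /=; rewrite scaleN1r opprK.
have Tle u : hnorm (T u) <= hnorm u.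
  have [ATu {2}<-] := T1 u.
  by have := positive_below ATu; rewrite mul1r scaleN1r opprK.
exists T; split => //.
have [z [Tz [_ [_ Tz2] /compact_op_seq Tzc]]] := Acpt.
(* Resolvent identity: [(A - z) (T u) = u - (1 + z) T u], so [Tz] sends this bounded sequence to
   [T (u n)]. *)
move=> u M uM; have [|v vP] := Tzc (fun n => u n - (1 + z) *: T (u n))
    (M + hnorm (1 + z) * M).
  move=> n; rewrite (le_trans (ler_hnormB _ _))// lerD// hnormZ.
  by rewrite ler_wpM2l ?hnorm_ge0// (le_trans (Tle _)).
exists v => e N /(vP e N)[n Nn]; have [ATu uE] := T1 (u n).
suff -> : Tz (u n - (1 + z) *: T (u n)) = T (u n) by exists n.
rewrite -[RHS](Tz2 _ ATu) /=; congr (Tz _).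
by rewrite -{1}uE scalerDl scale1r opprD addrA addrK.
Qed.

(** The orthogonal complement [N] of the eigenvectors is closed and invariant under
    [T = (A + 1)^-1]. If it were nonzero, it would contain an eigenvector of [T], thus one of [A],
    orthogonal to itself. *)
Lemma eigen_total u :
  (forall a w, dom A w -> A w = a *: w -> inner u w = 0) -> u = 0.
Proof.
move=> uE; have [T [T1 T2 Tle Tcpt]] := resolventN1.
pose E := [set w | dom A w /\ exists a, A w = a *: w].
pose N := [set u | forall w, E w -> inner u w = 0].
have Nu : N u by move=> w [Aw [a]]; exact: uE.
apply/eqP/negPn/negP => u0.
have TE a w : dom A w -> A w = a *: w -> w = (1 + a) *: T w.
  move=> Aw wE; rewrite -{1}(T2 w Aw) wE addrC scalerDl scale1r.
  by rewrite linearD linearZ.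
have Tsym v w : inner (T v) w = inner v (T w).
  have [Av vE] := T1 v; have [Aw wE] := T1 w.
  by rewrite -{1}wE -{2}vE innerDr innerDl (self_adjoint_sym Asa).
have [|v Tv0|v Nv w [Aw [a wE]]|m [w [m0 Nw w0 wE]]] :=
  @compact_eigenvector _ _ _ Tle Tsym _ _ Tcpt N u (orthogonal_closed E) _ Nu u0.
- move=> v; have [Av {2}<-] := T1 v.
  rewrite innerDr addr_ge0 ?hnorm_inner ?ler0c ?sqr_ge0//.
  by rewrite -self_adjoint_sym// Apos.
- by have [_ <-] := T1 v; rewrite Tv0 (app0 A) addr0.
(* Invariance of [N]: [T w] is a multiple of the eigenvector [w]; if [1 + a = 0] then [w] itself
   vanishes. *)
- rewrite Tsym; have wT := TE _ _ Aw wE.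
  have [a0|a0] := eqVneq (1 + a) 0.
    by rewrite wT a0 scale0r linear0 inner0r.
  have -> : T w = (1 + a)^-1 *: w by rewrite {2}wT scalerA mulVf// scale1r.
  by rewrite innerZr Nv ?mulr0//; split => //; exists a.
have mC : m%:C != 0 by rewrite fmorph_eq0 gt_eqF.
have [Aw' wE'] := T1 w.
have Aw : dom A w.
  have -> : w = m%:C^-1 *: T w by rewrite wE scalerA mulVf// scale1r.
  exact: domZ.
have : E w.
  (* [T w = m w] with [T = (A + 1)^-1] means [A w = (1 / m - 1) w]. *)
  split => //; exists (m%:C^-1 - 1); rewrite scalerBl scale1r -{2}wE' wE.
  by rewrite appZ// scalerDr !scalerA mulVf// !scale1r addrK.
by move=> /Nw/eqP; rewrite hnorm_inner fmorph_eq0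
  sqrf_eq0 hnorm_eq0 (negPf w0).
Qed.

Lemma eigen_closed_total (W : set H) : closed_subspace W ->
  (forall a w, dom A w -> A w = a *: w -> W w) -> forall u, W u.
Proof.
move=> Wc WE; apply: closed_subspace_total => // u uW.
by apply: eigen_total => a w Aw wE; exact: uW (WE _ _ Aw wE).
Qed.

(** If [a] is not an eigenvalue, [A - a] is bounded below: otherwise unit vectors [u_n] with
    [(A - a) u_n] tending to 0 would, by compactness, yield an eigenvector. A lower bound puts [a]
    in the resolvent set. *)
Lemma spectrum_eigenvalue a : spectrum A a -> eigenvalue_op A a.
Proof.
move=> Sa; have [T [T1 T2 Tle Tcpt]] := resolventN1.
apply: contrapT => Ea; apply: Sa.
have ker0 u : dom A u -> A u = a *: u -> u = 0.
  by move=> Au uE; apply/eqP/negPn/negP => u0; apply: Ea; exists u.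
suff [c c0 cP] : exists2 c : R, 0 < c &
    forall u, dom A u -> c * hnorm u <= hnorm (A u - a *: u).
  apply: resolvent_set_bounded_below c0 cP _ => // v Av vE.
  have [//|v0] := eqVneq v 0; apply: ker0 => //.
  have aR : a = Num.conj a.
    by rewrite -{1}(conjCK a); apply: (eigenvalue_real Asa); exists v.
  by rewrite aR.
apply: contrapT => /forall2NP nc.
have /choice[u uP] (n : nat) : exists u,
    [/\ dom A u, hnorm u = 1 & hnorm (A u - a *: u) < n.+1%:R^-1].
  have [|/existsNP[u /not_implyP[Au /negP]]] := nc n.+1%:R^-1.
    by rewrite invr_gt0.
  rewrite -ltNge => uE; have u0 : 0 < hnorm u.
    by have := le_lt_trans (hnorm_ge0 _) uE; rewrite pmulr_rgt0// invr_gt0.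
  exists ((hnorm u)^-1%:C *: u); split; first exact: domZ.
    by rewrite hnormZ hnormC gtr0_norm ?invr_gt0// mulVf// gt_eqF.
  rewrite appZ// scalerA mulrC -scalerA -scalerBr hnormZ hnormC.
  by rewrite gtr0_norm ?invr_gt0// mulrC ltr_pdivrMr.
have [|v vP] := Tcpt u 1; first by move=> n; case: (uP n) => _ ->.
(* Applying [T] to [A u + u] gives [u_n = (a + 1) T u_n + T (A u_n - a u_n)], so [u_n] clusters at
   [w] whenever [T u_n] clusters at [v]. *)
pose w := (a + 1) *: v.
pose k := hnorm (a + 1) + 1.
have k0 : 0 < k by rewrite ltr_wpDl// hnorm_ge0.
have wP (e : R) : 0 < e ->
    exists n, hnorm (v - T (u n)) < e /\ hnorm (w - u n) < e.
  move=> e0; have ek : 0 < e / k by rewrite divr_gt0.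
  have [M MP] := invS_lt ek; have [n Mn vn] := vP _ M ek; exists n.
  have [Au un rn] := uP n; have := lt_trans rn (MP n Mn) => {}rn.
  have ekk : hnorm (a + 1) * (e / k) + e / k = e.
    by rewrite -[X in _ + X]mul1r -mulrDl mulrCA mulfV ?mulr1// gt_eqF.
  have p0 : 0 <= hnorm (a + 1) * (e / k) by rewrite mulr_ge0 ?hnorm_ge0// ltW.
  split; first lra.
  have -> : w - u n = (a + 1) *: (v - T (u n)) - T (A (u n) - a *: u n).
    have -> : T (A (u n) - a *: u n) = u n - (a + 1) *: T (u n).
      rewrite scalerDl scale1r [a *: T _ + _]addrC opprD addrA linearB/= linearZ.
      by rewrite -{3}(T2 _ Au) linearD/= addrK.
    by rewrite scalerBr opprB subrKA.
  rewrite (le_lt_trans (ler_hnormB _ _))// hnormZ -ekk ler_ltD//.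
    by rewrite ler_wpM2l ?hnorm_ge0// ltW.
  exact: le_lt_trans (Tle _) rn.
have vE : v = T w.
  apply/eqP; rewrite -subr_eq0; apply/eqP/hnorm_small => e e0.
  have e2 : 0 < e / 2 by rewrite divr_gt0.
  have [n [h1 h2]] := wP _ e2.
  rewrite (le_lt_trans (ler_hdistD (T (u n)) _ _))//.
  have := Tle (u n - w); rewrite linearB/= [X in _ <= X]hnormB.
  by move: h1 h2; lra.
(* Since [v = T w], it satisfies [A v + v = (a + 1) v]. Its vanishing then contradicts
   [|u_n| = 1]. *)
have v0 : v = 0.
  have [Aw wE] := T1 w; rewrite -vE in Aw wE; apply: ker0 => //.
  by apply: (addIr v); rewrite wE /w scalerDl scale1r.
have [n [_]] := wP 1 ltr01; have [_ un _] := uP n.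
by rewrite /w v0 scaler0 sub0r hnormN un ltxx.
Qed.

End Spectral.

(** * Orthonormal bases of eigenspaces *)

Section Orthonormal.
Context {R : realType} {H : hilbertType R}.
Implicit Types (u v w : H) (W : set H).

Definition orthonormal_family (J : eqType) (b : J -> H) : Prop :=
  forall k l, inner (b k) (b l) = (k == l)%:R.

Lemma orthonormal_hnorm (J : eqType) (b : J -> H) k :
  orthonormal_family b -> hnorm (b k) = 1.
Proof.
move=> /(_ k k); rewrite eqxx hnorm_inner -[1%:R]/(1%:C) => /complexI/eqP.
by rewrite sqrp_eq1 ?hnorm_ge0// => /eqP.
Qed.

Lemma orthonormal_coef n (b : 'I_n -> H) (c : 'I_n -> R[i]) l :
  orthonormal_family b -> inner (\sum_(k < n) c k *: b k) (b l) = c l.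
Proof.
move=> bO; rewrite inner_suml (bigD1 l)//= innerZl bO eqxx mulr1 big1 ?addr0//.
by move=> k kl; rewrite innerZl bO (negPf kl) mulr0.
Qed.

Lemma orthonormal_is_basis W n (b : 'I_n -> H) : orthonormal_family b ->
  (forall k, W (b k)) ->
  (forall w, W w -> w = \sum_(k < n) inner w (b k) *: b k) -> is_basis W b.
Proof.
move=> bO bW bs; split=> // [c c0 k|w Ww]; last first.
  by exists (fun k => inner w (b k)); exact: bs.
by rewrite -(orthonormal_coef c k bO) c0 inner0l.
Qed.

(* If no finite orthonormal family spans [W], each one extends within [W], and
   iterating the extension gives an infinite one. *)
Lemma orthonormal_basis_exists W : W 0 ->
  (forall (c : R[i]) u v, W u -> W v -> W (c *: u + v)) ->
  ~ (exists2 x : nat -> H, forall n, W (x n) & orthonormal_family x) ->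
  exists n (b : 'I_n -> H), [/\ orthonormal_family b, forall k, W (b k) &
    forall w, W w -> w = \sum_(k < n) inner w (b k) *: b k].
Proof.
move=> W0 Wl; apply: contra_notP => nb.
pose good n (x : nat -> H) :=
  forall k, (k < n)%N -> W (x k) /\ forall l, (l < n)%N ->
    inner (x k) (x l) = (k == l)%:R.
(* Stated for every list, with a dummy [0] for bad ones, so that choice gives a total extension
   function. *)
have step (s : seq H) : exists w, good (size s) (nth 0 s) ->
    [/\ W w, inner w w = 1 &
      forall k, (k < size s)%N -> inner w (nth 0 s k) = 0].
  have [gs|ngs] := pselect (good (size s) (nth 0 s)); last by exists 0.
  have bO : orthonormal_family (fun k : 'I_(size s) => nth 0 s k).
    by move=> k l; have [_ ->] := gs k (ltn_ord k).
  have bW (k : 'I_(size s)) : W (nth 0 s k) by case: (gs k).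
  have [w [Ww]] : exists w, W w /\
      w <> \sum_(k < size s) inner w (nth 0 s k) *: nth 0 s k.
    apply: contrapT => /forallNP ww; apply: nb; exists (size s).
    exists (fun k => nth 0 s k); split=> // w Ww.
    by have /not_andP[//|/contrapT] := ww w.
  move=> /eqP; rewrite -subr_eq0; set y := _ - _ => y0.
  have ny : 0 < hnorm y by rewrite hnorm_gt0.
  have Ws : W (\sum_(k < size s) inner w (nth 0 s k) *: nth 0 s k).
    elim/big_ind: _ => // [u v Wu Wv|k _].
      by rewrite -[u]scale1r; exact: Wl.
    by rewrite -[_ *: _]addr0; exact: Wl.
  have Wy : W y by rewrite /y addrC -scaleN1r; exact: Wl.
  exists ((hnorm y)^-1%:C *: y) => _; split.
  - by rewrite -[_ *: _]addr0; exact: Wl.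
  - rewrite hnorm_inner hnormZ hnormC gtr0_norm ?invr_gt0//.
    by rewrite mulVf ?gt_eqF// expr1n.
  - move=> k ks; rewrite innerZl /y innerBl.
    have := orthonormal_coef (fun k : 'I_(size s) => inner w (nth 0 s k)).
    by move=> /(_ _ (Ordinal ks) bO) /= ->; rewrite subrr mulr0.
have [ext extP] := choice step.
(* [g n] lists the first [n] vectors, since each new one depends on all the earlier ones. *)
pose g := fix g n := if n is m.+1 then rcons (g m) (ext (g m)) else [::].
pose x n := ext (g n).
have gE n : g n = mkseq x n by elim: n => // n IH; rewrite mkseqS -IH.
have gx n k : (k < n)%N -> nth 0 (g n) k = x k.
  by move=> kn; rewrite gE nth_mkseq.
have gs n : size (g n) = n by rewrite gE size_mkseq.
have xg n : good n x -> [/\ W (x n), inner (x n) (x n) = 1 &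
    forall k, (k < n)%N -> inner (x n) (x k) = 0].
  move=> gn; have [|Wx x1 x0] := extP (g n).
    rewrite gs => k kn; have [Wk ok] := gn k kn; rewrite gx//; split=> // l ln.
    by rewrite gx// ok.
  by split => // k kn; rewrite -(gx n k kn) x0// gs.
have xgood n : good n x.
  elim: n => // n IH k; have [Wn n1 n0] := xg n IH.
  rewrite ltnS leq_eqVlt => /predU1P[->|kn].
    split=> // l; rewrite ltnS leq_eqVlt => /predU1P[->|ln].
      by rewrite eqxx.
    by rewrite n0// gtn_eqF.
  have [Wk ok] := IH k kn; split=> // l.
  rewrite ltnS leq_eqVlt => /predU1P[->|ln]; last exact: ok.
  by rewrite ltn_eqF// innerC0// n0.
exists x => [n|n m]; first by case: (xgood n.+1 n (ltnSn n)).
have [_ ->//] := xgood (maxn n m).+1 n (leq_maxl _ _).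
by rewrite ltnS leq_maxr.
Qed.

(** The two change-of-basis matrices have product the identity of size [n], and that product factors
    through size [m]. *)
Lemma is_basis_leq W n m (b : 'I_n -> H) (c : 'I_m -> H) :
  is_basis W b -> is_basis W c -> (n <= m)%N.
Proof.
move=> [bW bfree bspan] [cW _ cspan].
have /choice[M bM] k := cspan _ (bW k); have /choice[N cN] l := bspan _ (cW l).
apply: (@mulmx1_min _ n m (\matrix_(k, l) M k l) (\matrix_(l, k) N l k)).
apply/matrixP => k j; rewrite !mxE; apply/eqP; rewrite -subr_eq0; apply/eqP.
move: j; apply: bfree; under eq_bigr do rewrite scalerBl.
rewrite sumrB.
have -> : \sum_(j < n) (k == j)%:R *: b j = b k.
  rewrite (bigD1 k)//= eqxx scale1r big1 ?addr0// => j jk.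
  by rewrite eq_sym (negPf jk) scale0r.
apply/eqP; rewrite subr_eq0 [in eqbRHS]bM; apply/eqP.
under [RHS]eq_bigr do rewrite cN scaler_sumr.
rewrite exchange_big/=; apply: eq_bigr => j _; rewrite scaler_suml.
by apply: eq_bigr => l _; rewrite !mxE scalerA.
Qed.

Lemma dim_basis W n (b : 'I_n -> H) : is_basis W b -> Defs.dim W = Some n.
Proof.
move=> bW; apply: xget_unique; first by exists n => //; exists b.
move=> _ [m [c cW] <-]; congr Some; apply/eqP.
by rewrite eqn_leq (is_basis_leq bW cW) (is_basis_leq cW bW).
Qed.

End Orthonormal.

Section Eigenspaces.
Context {R : realType} {H : hilbertType R} {A : operator H}.
Hypotheses (Asa : self_adjoint A) (Apos : positive_op A)
  (Acpt : compact_resolvent A).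

Lemma ker_shiftP a u : ker (shift_op A a) u <-> dom A u /\ A u = a *: u.
Proof.
split=> -[Au /=]; first by move/eqP; rewrite subr_eq0 => /eqP.
by move=> uE; split => //=; rewrite uE subrr.
Qed.

(** An infinite orthonormal sequence of eigenvectors satisfies [x_n = (1 + a) T x_n]. Compactness of
    [T] would bring two terms close together, while their squared distance is 2. *)
Lemma eigenspace_basis a : exists n (b : 'I_n -> H),
  [/\ orthonormal_family b, forall k, ker (shift_op A a) (b k) &
    forall w, ker (shift_op A a) w -> w = \sum_(k < n) inner w (b k) *: b k].
Proof.
apply: orthonormal_basis_exists.
- by apply/ker_shiftP; rewrite app0 scaler0; split => //; exact: dom0.
- move=> c u v /ker_shiftP[Au uE] /ker_shiftP[Av vE]; apply/ker_shiftP.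
  split; first exact: domP.
  by rewrite Defs.appP// uE vE scalerDr !scalerA mulrC.
move=> [x xker xO]; have [T [T1 T2 Tle Tcpt]] := resolventN1 Asa Apos Acpt.
have xT n : x n = (1 + a) *: T (x n).
  have /ker_shiftP[Ax xE] := xker n.
  by rewrite -{1}(T2 _ Ax) xE addrC scalerDl scale1r linearD linearZ.
have [|v vP] := Tcpt x 1; first by move=> n; rewrite orthonormal_hnorm.
(* Two values [T x_n], [T x_m] within [1 / (2 k)] of [v] give [|x_n - x_m| <= |1 + a| / k <= 1]. *)
pose k := hnorm (1 + a) + 1.
have k0 : 0 < k by rewrite ltr_wpDl// hnorm_ge0.
have e0 : 0 < (2 * k)^-1 by rewrite invr_gt0 mulr_gt0.
have [n _ vn] := vP _ 0%N e0; have [m nm vm] := vP _ n.+1 e0.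
have : hnorm (x n - x m) ^+ 2 = 2.
  rewrite sqr_hnormB !(orthonormal_hnorm _ xO) xO ltn_eqF// mulr0.
  by rewrite subr0 expr1n.
suff : hnorm (x n - x m) ^+ 2 <= 1 by lra.
rewrite expr_le1 ?hnorm_ge0// (xT n) (xT m) -scalerBr hnormZ.
have h : hnorm (T (x n) - T (x m)) <= 2 * (2 * k)^-1.
  by have := ler_hdistD v (T (x n)) (T (x m)); rewrite (hnormB _ v); lra.
apply: le_trans (ler_wpM2l (hnorm_ge0 _) h) _.
have -> : 2 * (2 * k)^-1 = k^-1 by rewrite invfM mulrA mulfV ?mul1r// pnatr_eq0.
rewrite ler_pdivrMr// mul1r.
by rewrite /k lerDl.
Qed.

End Eigenspaces.

(** * The semigroup on eigenspaces *)

Section ExpEstimates.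
Context {R : realType}.
Implicit Types x : R.

(** The lower bound is [1 + x <= expR x]; the same bound at [- x] gives [expR x * (1 - x) <= 1],
    while [(1 + x + 2 x^2) (1 - x) >= 1] for [x <= 1/2]. *)
Lemma expR_sub1_sub x : `|x| <= 2^-1 -> `|expR x - 1 - x| <= 2 * x ^+ 2.
Proof.
move=> x2; have /andP[xl xu] : - 2^-1 <= x <= 2^-1 by rewrite -ler_norml.
have h1 := expR_ge1Dx x; have h2 := expR_ge1Dx (- x).
have ex := expR_gt0 x.
have h3 : expR x * (1 - x) <= 1.
  by rewrite -[leRHS](expRxMexpNx_1 x) ler_pM2l.
rewrite ger0_norm; last by lra.
have : expR x * (1 - x) <= (1 + x + 2 * x ^+ 2) * (1 - x).
  apply: (le_trans h3).
  have -> : (1 + x + 2 * x ^+ 2) * (1 - x) = 1 + x ^+ 2 * (1 - 2 * x) by ring.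
  by rewrite lerDl mulr_ge0 ?sqr_ge0//; lra.
by rewrite ler_pM2r; lra.
Qed.

End ExpEstimates.

Section Semigroup.
Context {R : realType} {H : hilbertType R} {A : operator H}
  {S : R -> {linear H -> H}}.
Hypotheses (Asa : self_adjoint A) (Apos : positive_op A)
  (Acpt : compact_resolvent A) (ASexp : is_exp_semigroup A S).
Implicit Types (u v w : H) (a : R[i]) (t e : R).

(** Clearing the quotient by [h] leaves an [o(h)] estimate, to which bounded operators apply
    directly. *)
Lemma generatorP u v : (dom A u /\ A u = v) <-> forall e : R, 0 < e ->
  \forall h \near 0^'+, hnorm (S h u - u + h%:C *: v) < e * h.
Proof.
have [_ _ _ _ gen] := ASexp; apply: (iff_trans (gen u v)).
apply: (iff_trans (hnorm_cvgP _ _ _)).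
have E e (h : R) : 0 < h ->
    (hnorm (- v - h%:C^-1 *: (S h u - u)) < e) =
    (hnorm (S h u - u + h%:C *: v) < e * h).
  move=> h0; have h0' : h%:C != 0.
    by rewrite fmorph_eq0 gt_eqF.
  have -> : S h u - u + h%:C *: v =
      - (h%:C *: (- v - h%:C^-1 *: (S h u - u))).
    by rewrite scalerBr scalerN scalerA mulfV// scale1r opprB opprK.
  by rewrite hnormN hnormZ hnormC gtr0_norm// mulrC ltr_pM2r.
split=> h e e0; near=> k; first by rewrite -E//; near: k; exact: h.
by rewrite E//; near: k; exact: h.
Unshelve. all: by end_near. Qed.

(** [S t] commutes with each [S k] and is bounded, so it carries the [o(k)] estimate at [u] to one
    at [S t u]. *)
Lemma semigroup_commute t u : 0 <= t -> dom A u ->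
  dom A (S t u) /\ A (S t u) = S t (A u).
Proof.
move=> t0 Au; have [Sb _ SD _ _] := ASexp.
have /bounded_opP[M M0 SM] := Sb t t0.
apply/generatorP => e e0.
have := (generatorP u (A u)).1 (conj Au erefl) (e / M).
rewrite divr_gt0// => /(_ isT) h; near=> k.
have k0 : 0 < k by near: k; exact: nbhs_right_gt.
have -> : S k (S t u) - S t u + k%:C *: S t (A u) =
    S t (S k u - u + k%:C *: A u).
  have -> : S k (S t u) = S t (S k u).
    by rewrite -(SD _ _ _ (ltW k0) t0) -(SD _ _ _ t0 (ltW k0)) addrC.
  by rewrite linearD/= linearB/= linearZ.
apply: (le_lt_trans (SM _)); rewrite mulrC -ltr_pdivlMr// mulrAC.
by near: k; exact: h.
Unshelve. all: by end_near. Qed.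

Section OnEigenspace.
Variable alpha : R.
Let V := ker (shift_op A alpha%:C).

Let semigroup_ker t u : 0 <= t -> V u -> V (S t u).
Proof.
move=> t0 /ker_shiftP[Au uE]; apply/ker_shiftP.
by have [ASu ->] := semigroup_commute t0 Au; rewrite uE linearZ.
Qed.

(** The semigroup with its expected decay on [V] compensated; the aim is that [B t] fixes [V]. *)
Let B h u := (expR (alpha * h))%:C *: S h u.

(** With [x = alpha h], the difference splits into [expR x] times the generator error, which is
    [o(h)], and [expR x - x expR x - 1] times [u], which is [O(h^2)]. *)
Let near_identity_basis e u : hnorm u = 1 -> V u -> 0 < e ->
  \forall h \near 0^'+, hnorm (B h u - u) <= e * h.
Proof.
move=> u1 /ker_shiftP[Au uE] e0.
have e4 : 0 < e / 4 by rewrite divr_gt0.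
have gen := (generatorP u (A u)).1 (conj Au erefl) _ e4; rewrite uE in gen.
(* [h < e / k] gives [4 x^2 <= e h / 2], and [h < 1 / k'] gives [|x| <= 1/2]. *)
pose k := 8 * (alpha ^+ 2 + 1).
have k0 : 0 < k by rewrite mulr_gt0// ltr_wpDl ?sqr_ge0.
pose k' := 2 * (`|alpha| + 1).
have k'0 : 0 < k' by rewrite mulr_gt0// ltr_wpDl.
near=> h.
have h0 : 0 < h by near: h; exact: nbhs_right_gt.
have h1 : h < e / k by near: h; apply: nbhs_right_lt; rewrite divr_gt0.
have h2 : h < k'^-1 by near: h; apply: nbhs_right_lt; rewrite invr_gt0.
have : hnorm (S h u - u + h%:C *: (alpha%:C *: u)) < e / 4 * h by near: h.
set D := S h u - _ + _ => De.
pose x := alpha * h.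
have x2 : `|x| <= 2^-1.
  rewrite normrM (gtr0_norm h0) -(@ler_pM2l _ 2)// mulfV ?pnatr_eq0// mulrA.
  move: h2; rewrite -[k'^-1]mul1r ltr_pdivlMr// /k' => h2.
  by have := normr_ge0 alpha; nra.
have Ex := expR_sub1_sub x2.
have x22 : 2 * x ^+ 2 <= 2^-1.
  rewrite -(real_normK (num_real x)).
  by have := normr_ge0 x; nra.
have eh : 4 * x ^+ 2 <= e / 2 * h.
  rewrite /x exprMn; move: h1; rewrite ltr_pdivlMr// /k => h1.
  have : h * (h * (8 * (alpha ^+ 2 + 1))) <= h * e by rewrite ler_pM2l// ltW.
  by have := sqr_ge0 h; nra.
have ex2 : expR x <= 2.
  by move: Ex x2; rewrite !ler_norml => /andP[_ ?] /andP[_ ?]; lra.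
have -> : B h u - u = (expR x)%:C *: D + (expR x - expR x * x - 1)%:C *: u.
  rewrite /B -/x /D !scalerA -rmorphM/= [h * _]mulrC -/x scalerDr scalerBr.
  rewrite scalerA -rmorphM/= !rmorphB/= rmorph1 !scalerBl scale1r -!addrA.
  by congr (_ + _); rewrite [X in _ = _ + X]addrCA addKr addNKr.
rewrite (le_trans (ler_hnormD _ _))// !hnormZ u1 mulr1 !hnormC.
rewrite (gtr0_norm (expR_gt0 _)).
have : expR x * hnorm D <= 2 * (e / 4 * h).
  by apply: ler_pM; rewrite ?expR_ge0 ?hnorm_ge0 ?(ltW De).
suff : `|expR x - expR x * x - 1| <= 4 * x ^+ 2 by lra.
have -> : expR x - expR x * x - 1 =
    (expR x - 1 - x) - x * (expR x - 1 - x) - x ^+ 2 by ring.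
apply: (le_trans (ler_normB _ _)).
apply: (le_trans (lerD (ler_normB _ _) (lexx _))).
rewrite normrM (ger0_norm (sqr_ge0 x)).
have := normr_ge0 (expR x - 1 - x).
move: (`|expR x - 1 - x|) Ex => y yx y0.
have : `|x| * y <= 2^-1 * y by rewrite ler_wpM2r.
by lra.
Unshelve. all: by end_near. Qed.

(* The eigenspace is finite dimensional, so the estimate is uniform on it. *)
Let near_identity e : 0 < e ->
  \forall h \near 0^'+, forall v, V v -> hnorm (B h v - v) <= e * h * hnorm v.
Proof.
move=> e0; have [n [b [bO bV bs]]] := eigenspace_basis Asa Apos Acpt alpha%:C.
(* Dividing by [n + 1] also covers a trivial eigenspace, where [n = 0]. *)
have en : 0 < e / n.+1%:R by rewrite divr_gt0.
have /filter_forall : forall k : 'I_n,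
    \forall h \near 0^'+, hnorm (B h (b k) - b k) <= e / n.+1%:R * h.
  by move=> k; apply: near_identity_basis (bV k) en; exact: orthonormal_hnorm.
move=> bh; near=> h => v Vv.
have h0 : 0 < h by near: h; exact: nbhs_right_gt.
have bhk : forall k, hnorm (B h (b k) - b k) <= e / n.+1%:R * h by near: h.
have -> : B h v - v = \sum_(k < n) inner v (b k) *: (B h (b k) - b k).
  under eq_bigr do rewrite scalerBr; rewrite sumrB -(bs _ Vv); congr (_ - _).
  rewrite {1}(bs _ Vv) /B linear_sum scaler_sumr; apply: eq_bigr => k _.
  by rewrite linearZ/= !scalerA mulrC.
apply: (le_trans (ler_hnorm_sum _ _ _)).
apply: (@le_trans _ _ (\sum_(k < n) (hnorm v * (e / n.+1%:R * h)))).
  apply: ler_sum => k _; rewrite hnormZ ler_pM ?hnorm_ge0//.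
  rewrite (le_trans (Cauchy_Schwarz _ _))//.
  by rewrite (orthonormal_hnorm _ bO) mulr1.
rewrite sumr_const card_ord -[leLHS]mulr_natr.
have n1 : n%:R / n.+1%:R <= 1 :> R by rewrite ler_pdivrMr// mul1r ler_nat.
have -> : hnorm v * (e / n.+1%:R * h) * n%:R =
  e * h * hnorm v * (n%:R / n.+1%:R) by move: (n.+1%:R^-1) => z; ring.
by rewrite ler_piMr// !mulr_ge0 ?hnorm_ge0// ltW.
Unshelve. all: by end_near. Qed.

Lemma semigroup_eigenvector t u : 0 <= t -> dom A u -> A u = alpha%:C *: u ->
  S t u = (expR (- (alpha * t)))%:C *: u.
Proof.
have [_ S0 SD _ _] := ASexp.
rewrite le_eqVlt => /predU1P[<- _ _|t0 Au uE].
  by rewrite mulr0 oppr0 expR0 S0 scale1r.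
have Vu : V u by apply/ker_shiftP.
suff : B t u - u = 0.
  move=> /eqP; rewrite subr_eq0 => /eqP {2}<-.
  by rewrite /B scalerA -rmorphM/= mulrC expRxMexpNx_1 scale1r.
apply: hnorm_small => d d0.
(* Ensures that [s = d / m] satisfies both [s <= 1/2] and [2 s |u| < d]. *)
pose m := 4 * (hnorm u + 1) * (1 + d).
have nu := hnorm_ge0 u.
have m0 : 0 < m by rewrite !mulr_gt0//; lra.
pose s := d / m.
have s0 : 0 < s by rewrite divr_gt0.
have s2 : s <= 2^-1 by rewrite ler_pdivrMr// /m; nra.
have e0 : 0 < s / t by rewrite divr_gt0.
have [/= r r0 rP] := near_identity e0.
(* The time [t] is cut into [M + 1] steps of length [h < r], where the estimate near the identity
   holds. *)
have [M MP] := invS_lt (divr_gt0 r0 t0).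
pose h := t / M.+1%:R; have h0 : 0 < h by rewrite divr_gt0.
have hr : forall v, V v -> hnorm (B h v - v) <= s / t * h * hnorm v.
  apply: rP => //=; rewrite sub0r normrN gtr0_norm//.
  by rewrite /h mulrC -ltr_pdivlMr// MP.
set q := s / t * h in hr; have q0 : 0 < q by rewrite mulr_gt0.
have h00 := ltW h0.
(* Each step moves a vector by at most [q] times its norm, and that norm is at most [(1 + q)^k |u|].
   At [k = M + 1] the growth factor is at most [expR s], as [s = (M + 1) q]. *)
have iter k : V (B (k%:R * h) u) /\
    hnorm (B (k%:R * h) u - u) <= ((1 + q) ^+ k - 1) * hnorm u.
  elim: k => [|k [Vk IH]].
    by rewrite mul0r /B mulr0 expR0 S0 scale1r subrr hnorm0 expr0 subrr mul0r.
  have kh0 : 0 <= k%:R * h by rewrite mulr_ge0.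
  have BS : B (k.+1%:R * h) u = B h (B (k%:R * h) u).
    rewrite /B linearZ/= scalerA -rmorphM/= -expRD -(SD _ _ _ h00 kh0).
    by rewrite -mulrDr -[k.+1]add1n natrD mulrDl mul1r.
  rewrite BS; split.
    have /ker_shiftP[Ak kE] := semigroup_ker h00 Vk; apply/ker_shiftP.
    by split; [exact: domZ | rewrite appZ// kE !scalerA mulrC].
  rewrite (le_trans (ler_hdistD (B (k%:R * h) u) _ _))//.
  apply: (le_trans (lerD (hr _ Vk) IH)).
  have : hnorm (B (k%:R * h) u) <= (1 + q) ^+ k * hnorm u.
    have := ler_hnormD (B (k%:R * h) u - u) u; rewrite subrK.
    by move: IH; rewrite mulrBl mul1r; lra.
  rewrite -(ler_pM2l q0) exprS => bq.
  apply: (le_trans (lerD bq (lexx _))).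
  by rewrite le_eqVlt; apply/orP; left; apply/eqP; ring.
have [_] := iter M.+1; rewrite {1}/h [M.+1%:R * _]mulrC divfK ?pnatr_eq0//.
move=> /le_lt_trans; apply.
have qs : (1 + q) ^+ M.+1 <= expR s.
  have -> : s = M.+1%:R * q.
    by rewrite /q /h mulrCA [M.+1%:R * _]mulrC divfK ?pnatr_eq0// divfK// gt_eqF.
  by rewrite expRM_natl lerXn2r ?nnegrE ?expR_ge1Dx ?expR_ge0// addr_ge0// ltW.
have es : expR s - 1 <= 2 * s.
  have : `|s| <= 2^-1 by rewrite gtr0_norm.
  move=> /expR_sub1_sub; rewrite ler_norml => /andP[_].
  have : s ^+ 2 <= 2^-1 * s by rewrite expr2 ler_wpM2r// ltW.
  by lra.
have : ((1 + q) ^+ M.+1 - 1) * hnorm u <= 2 * s * hnorm u.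
  by rewrite ler_wpM2r//; lra.
move=> /le_lt_trans; apply.
have : s * m = d by rewrite divfK// gt_eqF.
by rewrite /m; have := mulr_gt0 s0 d0; nra.
Qed.

End OnEigenspace.
End Semigroup.

(** * Extension of isometries *)

Section BoundedOperators.
Context {R : realType}.

Lemma bounded_op_comp (F G H : hilbertType R) (T : G -> H) (T' : F -> G) :
  bounded_op T -> bounded_op T' -> bounded_op (T \o T').
Proof.
move=> /bounded_opP[M M0 TM] /bounded_opP[M' M'0 TM'].
apply/bounded_opP; exists (M * M'); first exact: mulr_gt0.
by move=> u /=; rewrite (le_trans (TM _))// -mulrA ler_pM2l.
Qed.

(** The set where two bounded operators agree is a closed subspace. *)
Lemma linear_eq_total (G H : hilbertType R) (J : Type) (e : J -> G)
    (F F' : {linear G -> H}) :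
  (forall W, closed_subspace W -> (forall m, W (e m)) -> forall u, W u) ->
  bounded_op F -> bounded_op F' -> (forall m, F (e m) = F' (e m)) ->
  forall u, F u = F' u.
Proof.
move=> etot /bounded_opP[M M0 FM] /bounded_opP[M' M'0 FM'] eF.
apply: etot => //; split => [|c u v Fu Fv|u uF]; first by rewrite !linear0.
- by rewrite !linearP Fu Fv.
apply/eqP; rewrite -subr_eq0; apply/eqP/hnorm_small => d d0.
have k0 : 0 < M + M' by rewrite addr_gt0.
have [v vF uv] := uF _ (divr_gt0 d0 k0).
have -> : F u - F' u = F (u - v) - F' (u - v).
  by rewrite [F (_ - _)]linearB [F' (_ - _)]linearB vF opprB addrA subrK.
apply: (le_lt_trans (ler_hnormB _ _)).
apply: (le_lt_trans (lerD (FM _) (FM' _))).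
by rewrite -mulrDl mulrC -ltr_pdivlMr.
Qed.

End BoundedOperators.

Section IsometryExtension.
Context {R : realType} {G H : hilbertType R} {J : eqType} (e : J -> G)
  (f : J -> H).
Hypotheses (eO : orthonormal_family e) (fO : orthonormal_family f)
  (etot : forall W, closed_subspace W -> (forall m, W (e m)) -> forall u, W u).

Let closed_relation (P : G -> H -> Prop) :=
  [/\ P 0 0, forall (c : R[i]) u u' v v', P u v -> P u' v' ->
        P (c *: u + u') (c *: v + v') &
      forall u v, (forall d : R, 0 < d -> exists u' v',
        [/\ P u' v', hnorm (u - u') < d & hnorm (v - v') < d]) -> P u v].

(* The graph of the isometry is the smallest closed linear relation relating
   [e m] to [f m] for all [m]. *)
Let graph u v :=
  forall P, closed_relation P -> (forall m, P (e m) (f m)) -> P u v.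

Let graph_closed : closed_relation graph.
Proof.
split=> [P [P0 _ _]//|c u u' v v' uv uv' P Pc Pef|u v uv P Pc Pef].
  by case: (Pc) => _ Pl _; apply: Pl; [exact: uv|exact: uv'].
case: (Pc) => _ _; apply => d /uv[u' [v' [gr ? ?]]]; exists u', v'.
by split => //; exact: gr.
Qed.

Let inner_closed x y : closed_relation (fun u v => inner v y = inner u x).
Proof.
split=> [|c u u' v v' uv uv'|u v uv]; first by rewrite !inner0l.
  by rewrite !innerDl !innerZl uv uv'.
by apply: inner_eq_adherent => d /uv[u' [v' [? ? ?]]]; exists u', v'.
Qed.

(** Minimality of [graph] is used in each argument in turn, reducing the identity to the orthonormal
    pairs. *)
Let graph_inner u u' v v' : graph u v -> graph u' v' -> inner v v' = inner u u'.
Proof.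
move=> uv uv'; apply: uv (inner_closed u' v') _ => m.
rewrite innerJ [RHS]innerJ; congr Num.conj; apply: uv' (inner_closed _ _) _ => m'.
by rewrite eO fO.
Qed.

Let graph_hnorm u v : graph u v -> hnorm v = hnorm u.
Proof.
move=> uv; have := graph_inner uv uv; rewrite !hnorm_inner => /complexI/eqP.
by rewrite eqrXn2 ?hnorm_ge0// => /eqP.
Qed.

Let graph_sub u u' v v' : graph u v -> graph u' v' -> graph (u - u') (v - v').
Proof.
move=> uv uv'; rewrite (addrC u) (addrC v) -(scaleN1r u') -(scaleN1r v').
by case: graph_closed => _ gl _; exact: gl.
Qed.

(** The domain of [graph] is closed, since images of a Cauchy sequence are Cauchy, so it is all of
    [G]; norm preservation makes [graph] single-valued. *)
Lemma isometry_extension : exists U : {linear G -> H},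
  (forall u, hnorm (U u) = hnorm u) /\ forall m, U (e m) = f m.
Proof.
have [g0 gl gc] := graph_closed.
have [|c u u' v v'|u v v' uv uv'|U UP] := @linear_choice _ _ _ graph.
- apply: etot => [|m]; last by exists (f m) => P _; exact.
  split=> [|c u u' [v uv] [v' uv']|u uW]; first by exists 0.
    by exists (c *: v + v'); exact: gl.
  have /choice[w wP] (n : nat) : exists w : G * H,
      graph w.1 w.2 /\ hnorm (u - w.1) < n.+1%:R^-1.
    have [|x [y xy] ux] := uW n.+1%:R^-1; first by rewrite invr_gt0.
    by exists (x, y).
  have [|v vP] := @hnorm_complete R H (fun n => (w n).2).
    move=> d d0; have d2 : 0 < d / 2 by rewrite divr_gt0.
    have [N NP] := invS_lt d2; exists N => n m Nn Nm.
    have [gn un] := wP n; have [gm um] := wP m.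
    rewrite (graph_hnorm (graph_sub gn gm)) (le_lt_trans (ler_hdistD u _ _))//.
    have := lt_trans un (NP n Nn); have := lt_trans um (NP m Nm).
    by rewrite (hnormB _ u); lra.
  exists v; apply: gc => d d0; have [N NP] := vP d d0; have [M MP] := invS_lt d0.
  exists (w (maxn N M)).1, (w (maxn N M)).2; have [gw uw] := wP (maxn N M).
  split => //; last by apply: NP; exact: leq_maxl.
  by apply: lt_trans uw _; apply: MP; exact: leq_maxr.
- exact: gl.
- apply/eqP; rewrite -subr_eq0 -hnorm_eq0 (graph_hnorm (graph_sub uv uv')).
  by rewrite subrr hnorm0.
exists U; split=> [u|m]; first exact: graph_hnorm.
have gm : graph (e m) (f m) by move=> P _; exact.
apply/eqP; rewrite -subr_eq0 -hnorm_eq0 (graph_hnorm (graph_sub (UP _) gm)).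
by rewrite subrr hnorm0.
Qed.

End IsometryExtension.

(** * Dimension under linear isomorphisms *)

Section Dimension.
Context {R : realType}.

Lemma is_basis_linear_iso (G H : hilbertType R) (K : {linear G -> H})
    (K' : {linear H -> G}) (W : set G) (W' : set H) n (b : 'I_n -> G) :
  (forall u, W u -> W' (K u)) -> (forall v, W' v -> W (K' v)) ->
  cancel K K' -> cancel K' K -> is_basis W b -> is_basis W' (K \o b).
Proof.
move=> KW KW' KK' K'K [bW bfree bspan]; split=> [k|c c0|v Wv].
- exact/KW/bW.
- apply: bfree; rewrite -[LHS]KK' linear_sum.
  under eq_bigr do rewrite linearZ/=.
  by rewrite c0 linear0.
- have [c cE] := bspan _ (KW' _ Wv); exists c; rewrite -[LHS]K'K cE linear_sum.
  by under eq_bigr do rewrite linearZ/=.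
Qed.

Lemma dim_linear_iso (G H : hilbertType R) (K : {linear G -> H})
    (K' : {linear H -> G}) (W : set G) (W' : set H) :
  (forall u, W u -> W' (K u)) -> (forall v, W' v -> W (K' v)) ->
  cancel K K' -> cancel K' K -> Defs.dim W = Defs.dim W'.
Proof.
(* The two sets of basis lengths coincide, which also settles the infinite-dimensional case, where
   both are empty. *)
move=> KW KW' KK' K'K; rewrite /Defs.dim; congr (xget None (image _ _)).
apply/seteqP; split=> n [b bW].
  by exists (K \o b); exact: is_basis_linear_iso KW KW' KK' K'K bW.
by exists (K' \o b); exact: is_basis_linear_iso KW' KW K'K KK' bW.
Qed.

End Dimension.

(** * Intertwined semigroups *)

Section Scaling.
Context {R : realType} {H : hilbertType R} {A : operator H}.
Implicit Types a c : R[i].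

Lemma ker_scaleP c a u : c != 0 ->
  ker (shift_op A (c^-1 * a)) u <-> dom A u /\ c *: A u = a *: u.
Proof.
move=> c0; apply: (iff_trans (ker_shiftP _ _)); split=> -[Au uE]; split=> //.
  by rewrite uE scalerA mulrA mulfV// mul1r.
by rewrite -scalerA -uE scalerA mulVf// scale1r.
Qed.

Lemma spectrum_scale c a : c != 0 ->
  spectrum (scale_op c A) a -> spectrum A (c^-1 * a).
Proof.
move=> c0; apply: contra_not => -[T [Tb [T1 T2]]].
exists (c^-1 \*: T); split.
  have /bounded_opP[M M0 TM] := Tb; apply/bounded_opP.
  exists (hnorm c^-1 * M); first by rewrite mulr_gt0// hnorm_gt0 invr_eq0.
  by move=> u /=; rewrite hnormZ -mulrA ler_wpM2l ?hnorm_ge0.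
split=> [v|u Au] /=.
  have [Av vE] := T1 v; split; first exact: domZ.
  by rewrite appZ// !scalerA mulfV// scale1r mulrC -[RHS]vE.
rewrite -[RHS](T2 u Au) -linearZ/= scalerBr !scalerA mulVf// scale1r.
by [].
Qed.

Lemma eigenvalue_spectrum c a u : u != 0 -> dom A u -> c *: A u = a *: u ->
  spectrum (scale_op c A) a.
Proof.
move=> u0 Au uE [T [_ [_ T2]]].
have /= := T2 u Au; rewrite uE subrr linear0 => /esym/eqP.
by rewrite (negPf u0).
Qed.

End Scaling.

Section Intertwining.
Context {R : realType}.

Lemma near_right_scale (P : set R) (c : R) : 0 < c ->
  (\forall h \near 0^'+, P h) -> \forall h \near 0^'+, P (c * h).
Proof.
move=> c0 [/= r r0 rP]; exists (r / c) => /=; first by rewrite divr_gt0.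
move=> h /=; rewrite sub0r normrN => hr h0; apply: rP => /=; last exact: mulr_gt0.
by rewrite sub0r normrN normrM gtr0_norm// mulrC -ltr_pdivlMr.
Qed.

(** Differentiate the intertwining relation at 0: [K] sends the increment of [S] over time [k / l]
    to that of [T] over time [k]. *)
Lemma intertwined_generator (G H : hilbertType R) (A : operator G)
    (B : operator H) (S : R -> {linear G -> G}) (T : R -> {linear H -> H})
    (K : {linear G -> H}) (l : R) :
  is_exp_semigroup A S -> is_exp_semigroup B T -> 0 < l -> bounded_op K ->
  (forall t u, 0 <= t -> K (S t u) = T (l * t) (K u)) ->
  forall u, dom A u -> dom B (K u) /\ l%:C *: B (K u) = K (A u).
Proof.
move=> AS BT l0 /bounded_opP[M M0 KM] KST u Au.
have lC : l%:C != 0 by rewrite fmorph_eq0 gt_eqF.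
suff [BKu ->] : dom B (K u) /\ B (K u) = l%:C^-1 *: K (A u).
  by rewrite scalerA mulfV// scale1r.
apply/(generatorP BT) => e e0.
(* The factor [l] offsets the time [k / l], and [1 / M] offsets the bound on [K]. *)
have := (generatorP AS u (A u)).1 (conj Au erefl) (e * l / M).
rewrite divr_gt0 ?mulr_gt0// => /(_ isT).
have li : 0 < l^-1 by rewrite invr_gt0.
move=> /(near_right_scale li) h; near=> k.
have k0 : 0 < k by near: k; exact: nbhs_right_gt.
have : hnorm (S (l^-1 * k) u - u + (l^-1 * k)%:C *: A u) < e * l / M * (l^-1 * k).
  by near: k.
have -> : T k (K u) - K u + k%:C *: (l%:C^-1 *: K (A u)) =
    K (S (l^-1 * k) u - u + (l^-1 * k)%:C *: A u).
  have lk0 : 0 <= l^-1 * k by rewrite mulr_ge0 ?ltW.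
  rewrite linearD/= linearZ/= [K (_ - _)]linearB/= (KST _ _ lk0).
  rewrite mulVKf ?gt_eqF// scalerA -fmorphV -rmorphM/=.
  by rewrite linearZ.
rewrite -(ltr_pM2l M0) => /(le_lt_trans (KM _))/lt_le_trans; apply.
rewrite le_eqVlt; apply/orP; left; apply/eqP.
by field; rewrite !gt_eqF.
Unshelve. all: by end_near. Qed.

End Intertwining.

(** * The two implications for families *)

Section Families.
Context {R : realType} {I : Type} {H : I -> hilbertType R}.
Context {A : forall i, operator (H i)} {S : forall i, R -> {linear H i -> H i}}.
Hypotheses (Apos : forall i, positive_op (A i))
    (Asa : forall i, self_adjoint (A i))
    (Acpt : forall i, compact_resolvent (A i))
    (ASexp : forall i, is_exp_semigroup (A i) (S i)).
Variable tau : I -> R.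
Hypothesis tau0 : forall i, 0 < tau i.

Let tauC i : (tau i)%:C != 0.
Proof. by rewrite fmorph_eq0 gt_eqF. Qed.

Section IntertwinedSpectra.
Variable K : forall i j, {linear H j -> H i}.
Hypothesis SK : intertwined S tau K.

Let K_cancel i j : cancel (K i j) (K j i).
Proof.
have [Ki Kc _] := SK; have Kid k u : K k k u = u.
  have [_ [K' [_ KK' _]]] := Ki k k.
  (* [K k k] is idempotent and injective, hence the identity. *)
  by apply: (can_inj KK'); rewrite -Kc.
by move=> u; rewrite -Kc Kid.
Qed.

Let K_scale i j u : dom (A j) u ->
  dom (A i) (K i j u) /\
  (tau i)%:C *: A i (K i j u) = K i j ((tau j)%:C *: A j u).
Proof.
have [Ki _ KS] := SK; have l0 : 0 < tau i / tau j by rewrite divr_gt0.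
move=> Au; have [Kb _] := Ki i j.
have [AKu uE] := intertwined_generator (ASexp j) (ASexp i) l0 Kb (KS i j) Au.
split => //; rewrite linearZ/= -uE scalerA -rmorphM/=; congr (_%:C *: _).
by rewrite mulrC divfK// gt_eqF.
Qed.

(** Conjugating by [K] turns an inverse of [tau_i A_i - z] into one of [tau_j A_j - z]. *)
Lemma intertwined_resolvent i j z :
  resolvent_set (scale_op (tau i)%:C (A i)) z ->
  resolvent_set (scale_op (tau j)%:C (A j)) z.
Proof.
have [Ki _ _] := SK.
move=> [T [Tb [/= T1 T2]]]; exists (K j i \o (T \o K i j)).
split; first by apply: bounded_op_comp; [case: (Ki j i)|
  apply: bounded_op_comp => //; case: (Ki i j)].
split=> [v|u Au] /=.
  have [AT TE] := T1 (K i j v); have [AK ->] := K_scale j AT.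
  by split => //; rewrite -linearZ -linearB TE K_cancel.
have [AK uE] := K_scale i Au.
by rewrite linearB/= -uE linearZ/= T2// K_cancel.
Qed.

Lemma intertwined_same_spectra : same_spectra A tau.
Proof.
move=> i j; congr (~` _); apply/seteqP.
by split=> z; exact: intertwined_resolvent.
Qed.

Lemma intertwined_same_multiplicities : same_multiplicities A tau.
Proof.
move=> i j a _; apply: (@dim_linear_iso _ _ _ (K j i) (K i j)) => //.
  move=> u /(ker_scaleP _ _ (tauC i))[Au uE]; apply/ker_scaleP => //.
  by have [AK ->] := K_scale j Au; rewrite uE linearZ.
move=> u /(ker_scaleP _ _ (tauC j))[Au uE]; apply/ker_scaleP => //.
by have [AK ->] := K_scale i Au; rewrite uE linearZ.
Qed.

End IntertwinedSpectra.

Lemma simple_same_multiplicities : (forall i, simple_eigenvalues (A i)) ->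
  same_spectra A tau -> same_multiplicities A tau.
Proof.
move=> As sp i j a ia; have ja := ia; rewrite (sp i j) in ja.
by rewrite !As//; apply: spectrum_eigenvalue => //; exact: spectrum_scale.
Qed.

Section Construction.
Hypotheses (sp : same_spectra A tau) (mult : same_multiplicities A tau).

(** The index set consists of pairs of an arbitrary complex [alpha] and a [k] below its
    multiplicity. That multiplicity is the same for all [i], and is 0 off the common spectrum. *)
Lemma common_eigenbasis :
  exists (J : eqType) (r : J -> R) (e : forall i, J -> H i),
  [/\ forall i, orthonormal_family (e i),
      forall i W, closed_subspace W -> (forall m, W (e i m)) -> forall u, W u &
      forall i m, dom (A i) (e i m) /\
        A i (e i m) = ((tau i)^-1 * r m)%:C *: e i m].
Proof.
pose V i (alpha : R[i]) := ker (shift_op (A i) ((tau i)%:C^-1 * alpha)).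
have basis alpha : exists n, forall i, exists b : 'I_n -> H i,
    [/\ orthonormal_family b, forall k, V i alpha (b k) &
      forall w, V i alpha w -> w = \sum_(k < n) inner w (b k) *: b k].
  (* The length [n] must be fixed before [i]: it is read off at a reference index, and is arbitrary
     when [I] is empty. *)
  have [[i0 _]|noI] := pselect (exists i : I, True); last first.
    by exists 0%N => i; case: noI; exists i.
  have eb i := eigenspace_basis (Asa i) (@Apos i) (Acpt i) ((tau i)%:C^-1 * alpha).
  have spec i m (b : 'I_m -> H i) (k : 'I_m) : orthonormal_family b ->
      (forall k, V i alpha (b k)) -> spectrum (scale_op (tau i)%:C (A i)) alpha.
    move=> bO /(_ k)/(ker_scaleP _ _ (tauC i))[Ab bE].
    apply: eigenvalue_spectrum Ab bE.
    by rewrite -hnorm_gt0 (orthonormal_hnorm _ bO).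
  have [n [b0 [b0O b0V b0s]]] := eb i0; exists n => i.
  have [m [b [bO bV bs]]] := eb i.
  suff nm : n = m by rewrite nm; exists b.
  have dn := dim_basis (orthonormal_is_basis b0O b0V b0s).
  have dm := dim_basis (orthonormal_is_basis bO bV bs).
  have [sa|nsa] := pselect (spectrum (scale_op (tau i0)%:C (A i0)) alpha).
    by have := mult i sa; rewrite dn dm => -[].
  (* Off the spectrum both bases are empty, because a basis vector would be an eigenvector. *)
  transitivity 0%N.
    case: (n) b0 b0O b0V {b0s dn} => // n' b0 b0O b0V.
    by case: nsa; exact: spec ord0 b0O b0V.
  case: (m) b bO bV {bs dm} => // m' b bO bV.
  by case: nsa; rewrite (sp i0 i); exact: spec ord0 bO bV.
have [n nP] := choice basis.
pose b i alpha := projT1 (cid (nP alpha i)).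
have bP i alpha := projT2 (cid (nP alpha i)).
pose e i (x : {alpha : R[i] & 'I_(n alpha)}) := b i (tag x) (tagged x).
have eV i x : V i (tag x) (e i x) by have [_ + _] := bP i (tag x); exact.
exists {alpha : R[i] & 'I_(n alpha)}, (fun x => complex.Re (tag x)), e; split.
- move=> i [alpha k] [beta l]; have [ab|ab] := eqVneq alpha beta.
    move: l; rewrite -ab => l; rewrite eq_Tagged.
    by have [+ _ _] := bP i alpha; exact.
  have /ker_shiftP[Ak kE] := eV i (Tagged (fun alpha => 'I_(n alpha)) k).
  have /ker_shiftP[Al lE] := eV i (Tagged (fun alpha => 'I_(n alpha)) l).
  rewrite (eigen_orthogonal (Asa i) Ak Al kE lE); last first.
    by rewrite (inj_eq (mulfI _)) ?invr_eq0.
  by case: eqP => // /(congr1 tag)/= abE; rewrite abE eqxx in ab.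
- move=> i W Wc We; apply: (eigen_closed_total (Asa i) (@Apos i) (Acpt i) Wc).
  move=> a w Aw wE; have [_ _ bs] := bP i ((tau i)%:C * a).
  rewrite (bs w); last first.
    by apply/ker_scaleP => //; split => //; rewrite wE scalerA.
  apply: closed_subspace_sum => // k; apply: closed_subspaceZ => //.
  exact: (We (Tagged (fun alpha => 'I_(n alpha)) k)).
- move=> i [alpha k].
  have /ker_shiftP[Ak kE] := eV i (Tagged (fun alpha => 'I_(n alpha)) k).
  split=> //; rewrite kE /=; congr (_ *: _).
  (* An index exists only over an actual eigenvalue, so [alpha] is real and taking its real part
     loses nothing. *)
  have zR : (tau i)%:C^-1 * alpha \is Num.real.
    rewrite CrealE; apply/eqP; apply: (eigenvalue_real (Asa i)).
    exists (e i (Tagged (fun alpha => 'I_(n alpha)) k)); split => //.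
    rewrite -hnorm_gt0 (orthonormal_hnorm (b := b i alpha))//.
    by case: (bP i alpha).
  have aR : alpha \is Num.real.
    rewrite -[alpha](mulVKf (tauC i)) rpredM//.
    by apply/complex_realP; exists (tau i).
  by rewrite rmorphM/= fmorphV/= RRe_real.
Qed.

(** Each identity required of [K] is between bounded operators, so it is enough to check it on the
    eigenbasis, where the semigroups act by exponentials. *)
Lemma common_eigenbasis_intertwined (J : eqType) (r : J -> R)
  (e : forall i, J -> H i) :
  (forall i, orthonormal_family (e i)) ->
  (forall i W, closed_subspace W -> (forall m, W (e i m)) -> forall u, W u) ->
  (forall i m, dom (A i) (e i m) /\
        A i (e i m) = ((tau i)^-1 * r m)%:C *: e i m) ->
  exists K : forall i j, {linear H j -> H i}, intertwined S tau K.
Proof.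
move=> eO etot eA.
pose KP i j := isometry_extension (eO j) (eO i) (etot j).
pose K i j := projT1 (cid (KP i j)).
have Kn i j u : hnorm (K i j u) = hnorm u by have [] := projT2 (cid (KP i j)).
have Ke i j m : K i j (e j m) = e i m by have [_] := projT2 (cid (KP i j)).
have Kb i j : bounded_op (K i j).
  by apply/bounded_opP; exists 1 => // u; rewrite Kn mul1r.
have Kid i u : K i i u = u.
  have idb : bounded_op (idfun : H i -> H i).
    by apply/bounded_opP; exists 1 => // v; rewrite mul1r.
  exact: (linear_eq_total (F' := idfun) (etot i)).
have Kc i j k u : K i k u = K i j (K j k u).
  apply: (linear_eq_total (F' := K i j \o K j k) (etot k)) => //=.
    exact: bounded_op_comp.
  by move=> m; rewrite !Ke.
exists K; split => // [i j|i j t u t0].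
  by split => //; exists (K j i); split => // u; rewrite -Kc Kid.
have l0 : 0 <= tau i / tau j * t by rewrite mulr_ge0// divr_ge0// ltW.
have Sb k s : 0 <= s -> bounded_op (S k s) by have [+ _ _ _ _] := ASexp k; apply.
apply: (linear_eq_total (F := K i j \o S j t)
    (F' := S i (tau i / tau j * t) \o K i j) (etot j)) => [||m /=].
- by apply: bounded_op_comp => //; exact: Sb.
- by apply: bounded_op_comp => //; exact: Sb.
have [Aj ejE] := eA j m; have [Ai eiE] := eA i m.
rewrite Ke (semigroup_eigenvector (Asa j) (@Apos j) (Acpt j) (ASexp j) t0 Aj ejE).
rewrite (semigroup_eigenvector (Asa i) (@Apos i) (Acpt i) (ASexp i) l0 Ai eiE).
(* Both exponents equal [r m * t / tau j]: the time rescaling cancels [tau i]. *)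
rewrite linearZ/= Ke; congr ((expR (- _))%:C *: _).
by field; rewrite !gt_eqF.
Qed.

End Construction.

End Families.

Theorem theorem3p7 (R : realType) (I : Type) (H : I -> hilbertType R)
    (A : forall i, operator (H i)) (S : forall i, R -> {linear H i -> H i})
    (Hsep : forall i, separable (H i))
    (Apos : forall i, positive_op (A i))
    (Asa : forall i, self_adjoint (A i))
    (Acpt : forall i, compact_resolvent (A i))
    (ASexp : forall i, is_exp_semigroup (A i) (S i)) :
  ((exists tau : I -> R, (forall i, 0 < tau i) /\
      exists K : forall i j, {linear H j -> H i}, intertwined S tau K) <->
   (exists tau : I -> R,
      [/\ forall i, 0 < tau i, same_spectra A tau & same_multiplicities A tau]))
  /\
  ((forall i, simple_eigenvalues (A i)) ->
   ((exists tau : I -> R,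
      [/\ forall i, 0 < tau i, same_spectra A tau & same_multiplicities A tau])
    <->
    (exists tau : I -> R, (forall i, 0 < tau i) /\ same_spectra A tau))).
Proof.
split; [split|move=> As; split].
- move=> [tau [tau0 [K SK]]]; exists tau; split => //.
    exact: intertwined_same_spectra SK.
  exact: intertwined_same_multiplicities SK.
- move=> [tau [tau0 sp mult]]; exists tau; split => //.
  have [J [r [e [eO etot eA]]]] := common_eigenbasis Apos Asa Acpt tau0 sp mult.
  exact: (common_eigenbasis_intertwined Apos Asa Acpt ASexp tau0 eO etot eA).
- by move=> [tau [tau0 sp _]]; exists tau.
- move=> [tau [tau0 sp]]; exists tau; split => //.
  exact: simple_same_multiplicities.
Qed.
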